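(* Consider the discrete-time Markov chain on $\mathcal{K}_h$ with transition matrix $\pi$ and time step $\tau=1/\mathcal{T}$ (defined in the context). Suppose that $\kappa_+(i,j)>0$ for all $j\in\{1,\dots,d\}$ and all $i\in\mathcal{K}_h$ with $i+he_j\in\mathcal{K}_h$, and $\kappa_-(i,j)>0$ for all $j\in\{1,\dots,d\}$ and all $i\in\mathcal{K}_h$ with $i-he_j\in\mathcal{K}_h$, where $$\kappa_\pm(i,j)=c(i,\pm_j)-c(i\pm he_j,\pm_j)-\sum_{\gamma\in G\setminus\{+_j,-_j\}}\max\{c(i\pm he_j,\gamma)-c(i,\gamma),0\},$$ and set $\kappa_\phi=\min\{\kappa_+(i,j)+\kappa_-(i+he_j,j):\ j=1,\dots,d,\ i,\,i+he_j\in\mathcal{K}_h\}$. Let $\phi_1(x)=x\log x-x+1$ and $\phi_\alpha(x)=(\alpha-1)^{-1}(x^\alpha-x)-x+1$ for $1<\alpha\le2$. Then for every $\alpha\in[1,2]$ there is a constant $C_P>0$ with $0\le\mathcal{P}_\alpha(\pi^nf)\le C_P\,\mathcal{F}_\alpha(\pi^nf)$ for all $f\ge0$, $n\in\mathbb{N}$, such that, if $\tau<1/\kappa_\phi$, for all $f:\mathcal{K}_h\to[0,\infty)$ with $\mathcal{H}^{\phi_\alpha}(f|m_h)>0$ and all $n\in\mathbb{N}$, $$\mathcal{H}^{\phi_\alpha}(\pi^nf|m_h)\le C_f^\alpha\,e^{-\kappa_\phi n\tau}\,\mathcal{H}^{\phi_\alpha}(f|m_h),\qquad C_f^\alpha=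\frac{C_P\,\mathcal{F}_\alpha(f)}{\kappa_\phi\,\mathcal{H}^{\phi_\alpha}(f|m_h)}.$$
   Context: Setting. Let $d\ge1$, $K>0$, $D=[-K,K]^d$, $h>0$ with $2K/h\in\mathbb{N}$, $\sigma>0$, $V\in C^2(\mathbb{R}^d)$, and let $e_1,\dots,e_d$ be the standard basis of $\mathbb{R}^d$. The grid is $\mathcal{K}_h=\{i=(i_1,\dots,i_d): i_j=-K+hn_j-h/2,\ n_j\in\{1,\dots,2K/h\}\}$. Put $V^h(i)=h^{-d}\int_{[-h/2,h/2]^d}V(i+s)\,ds$. Let $G=\{+_1,-_1,\dots,+_d,-_d\}$ be the set of moves, where $\pm_j$ acts by $i\mapsto i\pm he_j$; write $\gamma i$ for the image of $i$ under $\gamma$. The rates are $c(i,\pm_j)=\frac{\sigma^2}{h^2}e^{-(V^h(i\pm he_j)-V^h(i))/(2\sigma^2)}$ if $i\pm he_j\in\mathcal{K}_h$ and $c(i,\pm_j)=0$ otherwise. The operator $\mathcal{L}_hf(i)=\sum_{\gamma\in G}c(i,\gamma)(f(\gamma i)-f(i))$ has the invariant probability measure $m_h(i)=Z^{-1}e^{-V^h(i)/\sigma^2}$, $Z=\sum_{i\in\mathcal{K}_h}e^{-V^h(i)/\sigma^2}$. Discrete-time chain: $\mathcal{T}=2\max_{i\in\mathcal{K}_h}\sum_{\gamma\in G}c(i,\gamma)$, $\tau=1/\mathcal{T}$, and $\pi$ is the transition matrix with $\pi(i,\gamma i)=c(i,\gamma)/\mathcal{T}$ for moves $\gamma$ with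 $\gamma i\in\mathcal{K}_h$, $\pi(i,i)=1-\sum_{\gamma\in G}c(i,\gamma)/\mathcal{T}$, and all other entries $0$; it acts by $\pi f(i)=\sum_{k\in\mathcal{K}_h}\pi(i,k)f(k)$. Entropy: $\mathcal{H}^\phi(f|m_h)=\sum_{i\in\mathcal{K}_h}\phi(f(i))m_h(i)-\phi\big(\sum_{i\in\mathcal{K}_h}f(i)m_h(i)\big)$. Dirichlet form: $\mathcal{E}(f,g)=\frac12\sum_{i\in\mathcal{K}_h}\sum_{\gamma\in G}c(i,\gamma)(f(\gamma i)-f(i))(g(\gamma i)-g(i))m_h(i)$. Entropy production and Fisher information: $\mathcal{P}_\alpha(f)=-\tau^{-1}\big(\mathcal{H}^{\phi_\alpha}(\pi f|m_h)-\mathcal{H}^{\phi_\alpha}(f|m_h)\big)$, $\mathcal{F}_\alpha(f)=\mathcal{E}(\phi_\alpha'(f),f)$. Convention for $\alpha=1$ ($\phi_1'(x)=\log x$, $0\log0=0$): in $\mathcal{F}_1$ a product $(\log a-\log b)(a-b)$ is $+\infty$ if exactly one of $a,b$ is $0$ and is $0$ if $a=b=0$; bounds with right-hand side $+\infty$ hold trivially. *)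

(* Defs.v *)
From HB Require Import structures.
From mathcomp Require Import all_boot all_order all_algebra.
From mathcomp Require Import all_classical all_reals all_analysis.

Set Implicit Arguments.
Unset Strict Implicit.
Unset Printing Implicit Defensive.

Import Order.TTheory GRing.Theory Num.Theory.
Import numFieldNormedType.Exports.

Local Open Scope classical_set_scope.
Local Open Scope ring_scope.

Section lebesgue_tuple.
Variable R : realType.
Let T := measurableTypeR R.

Definition tcons n (xt : T * n.-tuple T) : n.+1.-tuple T :=
  [the n.+1.-tuple T of xt.1 :: xt.2].

Lemma measurable_tcons n : measurable_fun [set: T * n.-tuple T] (@tcons n).
Proof. exact: measurable_cons. Qed.

HB.instance Definition _ n := isMeasurableFun.Build _ _ _ _
  (@tcons n) (@measurable_tcons n).

Definition tuncons n (t : n.+1.-tuple T) : T * n.-tuple T :=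
  (thead t, [tuple of behead t]).

Lemma measurable_tuncons n : measurable_fun [set: n.+1.-tuple T] (@tuncons n).
Proof.
apply/measurable_fun_pairP; split; first exact: measurable_tnth.
exact: measurable_behead.
Qed.

Lemma tconsK n : cancel (@tcons n) (@tuncons n).
Proof. by case=> x t; congr pair => //; exact/val_inj. Qed.

(* The library's sigma-finite instance of \x is shadowed by the one for finite
   measures, hence this direct proof. *)
Lemma product_measure_sigma_finite d1 d2
    (T1 : measurableType d1) (T2 : measurableType d2)
    (m1 : {sigma_finite_measure set T1 -> \bar R})
    (m2 : {sigma_finite_measure set T2 -> \bar R}) :
  sigma_finite setT (m1 \x m2)%E.
Proof.
have /sigma_finiteP[F [TF ndF Foo]] := sigma_finiteT m1.
have /sigma_finiteP[G [TG ndG Goo]] := sigma_finiteT m2.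
exists (fun n => F n `*` G n).
  rewrite -setXTT TF TG predeqE => -[x y]; split.
    move=> [/= [n _ Fnx] [k _ Gky]]; exists (maxn n k) => //; split.
    - by move: x Fnx; exact/subsetPset/ndF/leq_maxl.
    - by move: y Gky; exact/subsetPset/ndG/leq_maxr.
  by move=> [n _ []/= ? ?]; split; exists n.
move=> k; have [? ?] := Foo k; have [? ?] := Goo k.
split; first exact: measurableX.
by rewrite product_measure1E// lte_mul_pinfty// ge0_fin_numE.
Qed.

Lemma sigma_finite_tcons n
    (mu : set (T * n.-tuple T)%type -> \bar R) :
  sigma_finite setT mu ->
  sigma_finite [set: n.+1.-tuple T] (pushforward mu (@tcons n)).
Proof.
move=> [F FT mF].
exists (fun k => @tuncons n @^-1` F k).
  by rewrite -preimage_bigcup -FT preimage_setT.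
move=> k; have [mFk Fk_oo] := mF k; split.
  by rewrite -[X in measurable X]setTI; exact: measurable_tuncons.
rewrite /pushforward -comp_preimage.
by rewrite (_ : _ \o _ = id) //; apply/funext => x; exact: tconsK.
Qed.

Section step.
Variables (n : nat) (mu : {sigma_finite_measure set (n.-tuple T) -> \bar R}).

Definition lebesgue_step : set (n.+1.-tuple T) -> \bar R :=
  pushforward (@lebesgue_measure R \x mu)%E (@tcons n).

Let lebesgue_step0 : lebesgue_step set0 = 0%E.
Proof. exact: measure0. Qed.

Let lebesgue_step_ge0 A : (0 <= lebesgue_step A)%E.
Proof. exact: measure_ge0. Qed.

Let lebesgue_step_sigma_additive : semi_sigma_additive lebesgue_step.
Proof.
exact: measure_semi_sigma_additive.
Qed.

HB.instance Definition _ := isMeasure.Build _ _ _ lebesgue_step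
  lebesgue_step0 lebesgue_step_ge0 lebesgue_step_sigma_additive.
Let lebesgue_step_sigma_finite : sigma_finite setT lebesgue_step.
Proof. by apply: sigma_finite_tcons; exact: product_measure_sigma_finite. Qed.

HB.instance Definition _ := Measure_isSigmaFinite.Build _ _ _ lebesgue_step
  lebesgue_step_sigma_finite.
End step.

(* Lebesgue measure on R^n, R^n being encoded as n.-tuple R: the n-fold product
   of the Lebesgue measure on R. *)
Fixpoint lebesgue_tuple n : {sigma_finite_measure set (n.-tuple T) -> \bar R} :=
  if n is n'.+1 return {sigma_finite_measure set (n.-tuple T) -> \bar R}
  then lebesgue_step (lebesgue_tuple n')
  else \d_([tuple] : 0.-tuple T).

Lemma lebesgue_tuple_box n (A : 'I_n -> set T) :
  (forall i, measurable (A i)) ->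
  lebesgue_tuple n [set t | forall i, A i (tnth t i)] =
  (\prod_(i < n) @lebesgue_measure R (A i))%E.
Proof.
elim: n A => [|n IHn] A mA.
  rewrite big_ord0 /= diracE mem_set // => i.
  by case: i.
rewrite big_ord_recl -IHn; last by move=> i; exact: mA.
rewrite /= /lebesgue_step /pushforward.
rewrite (_ : _ @^-1` _ =
    A ord0 `*` [set t | forall i, A (lift ord0 i) (tnth t i)]); last first.
  apply/seteqP; split=> -[x t] /=.
    move=> At; split=> [|i]; first exact: (At ord0).
    by have := At (lift ord0 i); rewrite tnthS.
  by move=> [Ax At] i; case: (unliftP ord0 i) => [j ->|-> //]; rewrite tnthS.
rewrite product_measure1E //.
rewrite (_ : mkset _ = \bigcap_(i in [set: 'I_n])
    ((fun t => tnth t i) @^-1` A (lift ord0 i))); last first.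
  by apply/seteqP; split=> t At i; [move=> _; exact: At|exact: (At i I)].
apply: fin_bigcap_measurable => // i _.
by rewrite -[X in measurable X]setTI; exact: measurable_tnth.
Qed.

End lebesgue_tuple.

Section C2.
Variables (R : realType) (d : nat).
Implicit Type V : 'rV[R]_d -> R.

Definition basis_vec (j : 'I_d) : 'rV[R]_d := delta_mx 0 j.

Definition C2 V : Prop :=
  [/\ continuous V,
      forall j x, derivable V x (basis_vec j),
      forall j, continuous (fun x => 'D_(basis_vec j) V x),
      forall j k x,
        derivable (fun y => 'D_(basis_vec j) V y) x (basis_vec k) &
      forall j k, continuous
        (fun x => 'D_(basis_vec k) (fun y => 'D_(basis_vec j) V y) x)].

End C2.

Section Phi.
Variable R : realType.

Definition phi (alpha x : R) : R :=
  if alpha == 1 then x * ln x - x + 1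
  else (alpha - 1)^-1 * (x `^ alpha - x) - x + 1.

(* The derivative of phi alpha, with value log 0 = -oo at 0 if alpha = 1. *)
Definition dphi (alpha x : R) : \bar R :=
  if alpha == 1 then lne x%:E
  else ((alpha - 1)^-1 * (alpha * x `^ (alpha - 1) - 1) - 1)%:E.

Lemma is_derive_phi (alpha x : R) : 0 < x ->
  is_derive x 1 (phi alpha) (fine (dphi alpha x)).
Proof.
move=> x0; rewrite /dphi; have [->|a1] := eqVneq alpha 1.
  rewrite lne_EFin //= (_ : phi 1 = fun y => y * ln y - y + 1); last first.
    by apply/funext => y; rewrite /phi eqxx.
  have lnx := is_derive1_ln x0.
  apply: is_derive_eq.
  rewrite /GRing.scale /= mulr1 divff ?gt_eqF // addr0.
  by rewrite addrC addrA addNr add0r.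
rewrite (_ : phi alpha =
    fun y => (alpha - 1)^-1 * (y `^ alpha - y) - y + 1); last first.
  by apply/funext => y; rewrite /phi (negbTE a1).
have powx : is_derive x 1 (@powR R ^~ alpha) (alpha * x `^ (alpha - 1)).
  exact: is_derive1_powR.
apply: is_derive_eq.
by rewrite addr0 /GRing.scale.
Qed.

(* The convention for alpha = 1: a product of differences is +oo if exactly one
   of a and b is 0, and is 0 if both are. *)
Lemma dphi1_gt0 (a b : R) : 0 < a -> 0 < b ->
  ((dphi 1 a - dphi 1 b) * (a%:E - b%:E) = ((ln a - ln b) * (a - b))%:E)%E.
Proof. by move=> a0 b0; rewrite /dphi eqxx !lne_EFin. Qed.

Lemma dphi1_0 : dphi 1 0 = -oo%E.
Proof. by rewrite /dphi eqxx le0_lneNy. Qed.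

Lemma dphi1_0r (a : R) : 0 < a ->
  ((dphi 1 a - dphi 1 0) * (a%:E - 0%:E) = +oo)%E.
Proof.
move=> a0; rewrite dphi1_0 /dphi eqxx lne_EFin // sube0.
by rewrite addey // gt0_mulye // lte_fin.
Qed.

Lemma dphi1_0l (b : R) : 0 < b ->
  ((dphi 1 0 - dphi 1 b) * (0%:E - b%:E) = +oo)%E.
Proof.
move=> b0; rewrite dphi1_0 /dphi eqxx lne_EFin // sub0e.
by rewrite addNye lt0_mulNye // lte_fin oppr_lt0.
Qed.

Lemma dphi1_00 : ((dphi 1 0 - dphi 1 0) * (0%:E - 0%:E) = 0 :> \bar R)%E.
Proof. by rewrite [X in (_ * X)%E]subee // mule0. Qed.

End Phi.

(* The multi-index n of a grid point; its coordinate n_j \in {1, .., N} is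
   encoded by the ordinal n_j - 1 < N. *)
Definition grid (d N : nat) := {ffun 'I_d -> 'I_N}.

(* (j, true) is +_j and (j, false) is -_j. *)
Definition moves (d : nat) := ('I_d * bool)%type.

Definition plus_ d (j : 'I_d) : moves d := (j, true).
Definition minus_ d (j : 'I_d) : moves d := (j, false).

Section Chain.
Variables (R : realType) (d N : nat) (K h sigma : R) (V : 'rV[R]_d -> R).
Implicit Types (i k : grid d N) (j : 'I_d) (g : moves d) (f : grid d N -> R).

Definition pt i : 'rV[R]_d := \row_j (- K + h * (i j).+1%:R - h / 2).

Definition shift g (x : 'rV[R]_d) : 'rV[R]_d :=
  if g.2 then x + h *: basis_vec R g.1 else x - h *: basis_vec R g.1.

Definition stays g i : bool := [exists k, pt k == shift g (pt i)].

(* [act g i] is the index of the grid point g i; it is i itself, a value which is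
   always weighted by a zero rate, when g i is not in the grid. *)
Definition act g i : grid d N := odflt i [pick k | pt k == shift g (pt i)].

Definition Vh (x : 'rV[R]_d) : R :=
  (h ^+ d)^-1 *
  \int[lebesgue_tuple R d]_(s in
      [set s : d.-tuple (measurableTypeR R) |
         forall j, tnth s j \in `[- (h / 2), h / 2]])
    V (x + \row_j tnth s j).

Definition rate i g : R :=
  if stays g i
  then sigma ^+ 2 / h ^+ 2 *
       expR (- ((Vh (shift g (pt i)) - Vh (pt i)) / (2 * sigma ^+ 2)))
  else 0.

Definition Zpart : R := \sum_i expR (- (Vh (pt i) / sigma ^+ 2)).

Definition mh i : R := Zpart^-1 * expR (- (Vh (pt i) / sigma ^+ 2)).

(* All terms are nonnegative, so 0 is a harmless default for the maximum. *)
Definition Tmax : R :=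
  2 * \big[Num.max/0]_(i : grid d N) \sum_g rate i g.

Definition tau : R := Tmax^-1.

(* At most one move g contributes to the sum. *)
Definition trans i k : R :=
  if k == i then 1 - (\sum_g rate i g) / Tmax
  else \sum_(g | pt k == shift g (pt i)) rate i g / Tmax.

Definition pi_op f : grid d N -> R := fun i => \sum_k trans i k * f k.

Definition entropy (phi : R -> R) f : R :=
  \sum_i phi (f i) * mh i - phi (\sum_i f i * mh i).

(* Extended-real valued, to accommodate phi_1'(0) = log 0 = -oo. *)
Definition dirichlet (u v : grid d N -> \bar R) : \bar R :=
  ((2^-1)%:E * \sum_i \sum_g
     (rate i g)%:E * ((u (act g i) - u i) * (v (act g i) - v i)) * (mh i)%:E)%E.

Definition production (alpha : R) f : R :=
  - (tau^-1 * (entropy (phi alpha) (pi_op f) - entropy (phi alpha) f)).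

Definition fisher (alpha : R) f : \bar R :=
  dirichlet (fun i => dphi alpha (f i)) (fun i => (f i)%:E).

Definition kappa_plus i j : R :=
  rate i (plus_ j) - rate (act (plus_ j) i) (plus_ j)
  - \sum_(g | (g != plus_ j) && (g != minus_ j))
      Num.max (rate (act (plus_ j) i) g - rate i g) 0.

Definition kappa_minus i j : R :=
  rate i (minus_ j) - rate (act (minus_ j) i) (minus_ j)
  - \sum_(g | (g != plus_ j) && (g != minus_ j))
      Num.max (rate (act (minus_ j) i) g - rate i g) 0.

(* The set is finite, so this is its minimum; it is empty only if the grid is
   reduced to a point. *)
Definition kappa_phi : R :=
  inf [set x | exists i j, stays (plus_ j) i /\
         x = kappa_plus i j + kappa_minus (act (plus_ j) i) j].

End Chain.

(* Main.v *)
(* Write F for the Fisher information. Convexity of phi gives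
   H (pi f) <= H f <= H (pi f) + tau * F f, so that C_P = 1 is admissible. The
   contraction F (pi f) <= (1 - kappa tau) * F f follows from Conforti's
   coupling method: (phi' a - phi' b) (a - b) is jointly convex, hence F (pi f)
   is at most the average of this function over a coupling of the chains started
   at the endpoints of the edges. The coupling moves an edge to an edge,
   reversibly with respect to the weights of the edges in F, except that the edge
   collapses at a rate which is at least kappa. Summing the geometric series in
   H (pi^n f) <= H (pi^(n + k) f)
                 + tau * (F (pi^n f) + ... + F (pi^(n + k - 1) f))
   and letting k go to infinity yields the exponential decay for positive f; the
   case of nonnegative f follows by adding a constant e > 0 and letting e go
   to 0, or is trivial because F f = +oo. *)

Require Import Defs.
From mathcomp Require Import all_boot all_order all_algebra.
From mathcomp Require Import all_classical all_reals all_analysis.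
From mathcomp Require Import ring lra zify.

Set Implicit Arguments.
Unset Strict Implicit.
Unset Printing Implicit Defensive.

Import Order.TTheory GRing.Theory Num.Theory.
Import numFieldNormedType.Exports.

Local Open Scope classical_set_scope.
Local Open Scope ring_scope.

(** * The functions phi *)

Section psi.
Variable R : realType.
Implicit Types p x y a b : R.

(** Young's inequality for the [p]-th power of [x] and 1, with the conjugate exponents [p^-1] and
    [(1 - p)^-1]. *)
Lemma powR_le_tangent1 p x : 0 <= p <= 1 -> 0 < x -> x `^ p <= 1 + p * (x - 1).
Proof.
move=> /andP[p0 p1] x0.
have [->|pn0] := eqVneq p 0; first by rewrite powRr0; lra.
have [->|pn1] := eqVneq p 1; first by rewrite powRr1 ?(ltW x0)// mul1r subrKC.
have pgt0 : 0 < p by rewrite lt_neqAle eq_sym pn0.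
have plt1 : 0 < 1 - p by rewrite subr_gt0 lt_neqAle pn1.
have := @conjugate_powR R (x `^ p) 1 p^-1 (1 - p)^-1 (powR_ge0 _ _) ler01.
rewrite !invr_gt0 powR1 mulr1 mul1r => /(_ pgt0 plt1).
rewrite !invrK (addrC p) subrK -powRrM divff// powRr1 ?(ltW x0)//
  => /(_ erefl)/le_trans; apply.
by rewrite le_eqVlt; apply/orP; left; apply/eqP; ring.
Qed.

(* The primitive of x `^ (p - 1) that vanishes at 1. *)
Definition psi p x := if p == 0 then ln x else (x `^ p - 1) / p.

(** Concavity of [psi p]. By scaling it reduces to the tangent at 1, evaluated at [y / x]. *)
Lemma psi_tangent p x y : 0 <= p <= 1 -> 0 < x -> 0 < y ->
  psi p y <= psi p x + x `^ (p - 1) * (y - x).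
Proof.
move=> p01 x0 y0; rewrite /psi; have yx0 : 0 < y / x by exact: divr_gt0.
have [->|pn0] := eqVneq p 0.
  rewrite sub0r powR_inv1 ?(ltW x0)// -lerBlDl -ln_div//.
  rewrite mulrBr mulVf ?gt_eqF// (mulrC x^-1).
  have {1}-> : y / x = 1 + (y / x - 1) by rewrite subrKC.
  by rewrite le_ln1Dx// ltrBrDr addrC subrr.
have pgt0 : 0 < p by case/andP: p01 => p0 _; rewrite lt_neqAle eq_sym pn0.
have e : x `^ p = x * x `^ (p - 1) by rewrite mulr_powRB1// ltW.
have := powR_le_tangent1 p01 yx0.
rewrite -(ler_pM2l (powR_gt0 p x0)) -powRM ?(ltW x0) ?(ltW yx0)//.
rewrite mulrC divfK ?gt_eqF// => h.
rewrite -lerBlDl -mulrBl ler_pdivrMr// opprB addrA subrK lerBlDl.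
apply: (le_trans h); rewrite mulrDr mulr1 lerD2l e.
rewrite le_eqVlt; apply/orP; left; apply/eqP; field.
by rewrite gt_eqF.
Qed.

Lemma mul_psi p x : 0 < x -> p * psi p x = x `^ p - 1.
Proof.
move=> x0; rewrite /psi; have [->|pn0] := eqVneq p 0.
  by rewrite mul0r powRr0 subrr.
by rewrite mulrC divfK.
Qed.

Lemma mulr_powRB1_gt0 p x : 0 < x -> x * x `^ (p - 1) = x `^ p.
Proof.
move=> x0; rewrite -{1}(powRr1 (ltW x0)) -powRD ?subrKC//.
by rewrite (lt0r_neq0 x0) implybT.
Qed.

(** With [alpha = 1 + p], one formula covers the logarithmic case [p = 0] and the power case; [p] is
    the parameter from here on. *)
Lemma phi_psi p x : 0 <= p -> 0 <= x -> phi (1 + p) x = x * psi p x - x + 1.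
Proof.
move=> p0 x0; rewrite /phi /psi -subr_eq0 [1 + p - 1]addrC addKr.
case: eqVneq => // pn0.
have [->|xn0] := eqVneq x 0.
  by rewrite powR0 ?gt_eqF ?ltr_pwDl//; field.
by rewrite powRD ?xn0 ?implybT// powRr1//; field.
Qed.

(** For [p] in [0, 1], the points at which the derivative of [phi (1 + p)] is finite: 0 is excluded
    exactly when [p = 0]. *)
Definition psi_dom p x := (0 <= x) && ((0 < x) || (0 < p)).

Lemma gt0_psi_dom p x : 0 < x -> psi_dom p x.
Proof. by rewrite /psi_dom => x0; rewrite ltW// x0. Qed.

Lemma dphi_psi p x : psi_dom p x -> dphi (1 + p) x = ((1 + p) * psi p x)%:E.
Proof.
move=> /andP[x0 xp]; rewrite /dphi /psi -subr_eq0 [1 + p - 1]addrC addKr.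
case: eqVneq xp => [->|pn0 _]; last by congr EFin; field.
by rewrite ltxx orbF addr0 mul1r => /lne_EFin ->.
Qed.

Lemma ler_psi p x y : 0 <= p <= 1 -> psi_dom p x -> x <= y ->
  psi p x <= psi p y.
Proof.
move=> /andP[p0 p1] /andP[x0 xp] xy; rewrite /psi.
case: eqVneq xp => [->|pn0 _].
  by rewrite ltxx orbF => x_gt0; rewrite ler_ln ?posrE// (lt_le_trans x_gt0).
rewrite ler_pM2r ?invr_gt0 ?lt_neqAle 1?eq_sym ?pn0// lerD2r.
by rewrite ge0_ler_powR ?nnegrE// (le_trans x0).
Qed.

(** Convexity of [phi (1 + p)]. For positive [x] and [y], the tangent inequality of [psi p] at [y],
    multiplied by [y], leaves the product of [y - x] and the difference of the [p]-th powers, which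
    is nonnegative by monotonicity. *)
Lemma phi_tangent p x y : 0 <= p <= 1 -> psi_dom p x -> 0 <= y ->
  phi (1 + p) x + (1 + p) * psi p x * (y - x) <= phi (1 + p) y.
Proof.
move=> p01 /andP[x0 xp] y0; have /andP[p0 p1] := p01.
rewrite !phi_psi//.
have [xE|xn0] := eqVneq x 0.
  move: xp; rewrite xE ltxx/= => pgt0; have pn0 : p != 0 by rewrite gt_eqF.
  rewrite /psi (negbTE pn0) powR0//.
  have : 0 <= y * (y `^ p / p) by rewrite mulr_ge0// divr_ge0// powR_ge0.
  set z := y `^ p; move=> h; rewrite -subr_ge0.
  by rewrite [leRHS](_ : _ = y * (z / p)) //; field.
have {}xp : 0 < x by rewrite lt_neqAle eq_sym xn0.
have px := mul_psi p xp.
have [yE|yn0] := eqVneq y 0.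
  rewrite yE; have := mulr_ge0 x0 (powR_ge0 x p); nra.
have {}y0 : 0 < y by rewrite lt_neqAle eq_sym yn0.
have := psi_tangent p01 y0 xp.
rewrite -(ler_pM2l y0) mulrDr mulrA mulr_powRB1_gt0//.
have : 0 <= (y - x) * (y `^ p - x `^ p).
  have [xy|/ltW yx] := leP x y.
    by rewrite mulr_ge0// subr_ge0// ge0_ler_powR ?nnegrE// ltW.
  by rewrite mulr_le0// subr_le0// ge0_ler_powR ?nnegrE// ltW.
have -> : (1 + p) * psi p x * (y - x) = (psi p x + (x `^ p - 1)) * (y - x).
  by rewrite -px; ring.
by move=> *; lra.
Qed.

(** * The edge integrand of the Fisher information and its joint convexity *)

Definition theta p a b := (psi p a - psi p b) * (a - b).

Lemma theta_ge0 p a b : 0 <= p <= 1 -> psi_dom p a -> psi_dom p b ->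
  0 <= theta p a b.
Proof.
move=> p01 a0 b0; rewrite /theta; have [ab|/ltW ba] := leP a b.
  by rewrite mulr_le0 ?subr_le0 ?ler_psi.
by rewrite mulr_ge0 ?subr_ge0 ?ler_psi.
Qed.

Lemma thetaC p a b : theta p a b = theta p b a.
Proof. by rewrite /theta; ring. Qed.

Lemma thetaxx p a : theta p a a = 0.
Proof. by rewrite /theta subrr mul0r. Qed.

(** The derivative of [psi p] at [x] is the power of [x] with exponent [p - 1 <= 0], so on (0, M] it
    is smallest at [M]. *)
Lemma theta_ge p a b M : 0 <= p <= 1 -> 0 < a <= M -> 0 < b <= M ->
  M `^ (p - 1) * (a - b) ^+ 2 <= theta p a b.
Proof.
move=> p01; wlog : a b / a <= b => [hw aM bM|ab /andP[a0 aM] /andP[b0 bM]].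
  have [ab|/ltW ba] := leP a b; first exact: hw.
  by rewrite thetaC -(opprB b a) sqrrN; exact: hw.
have Mb : M `^ (p - 1) <= b `^ (p - 1).
  rewrite -opprB !powRN lef_pV2 ?posrE ?powR_gt0 ?(lt_le_trans b0)//.
  have /andP[_ p1] := p01.
  have M0 := lt_le_trans b0 bM.
  by rewrite ge0_ler_powR ?nnegrE ?subr_ge0 ?(ltW M0) ?(ltW b0).
have := psi_tangent p01 b0 a0.
rewrite /theta -subr_ge0 => h; rewrite -subr_ge0.
have ab0 : 0 <= b - a by rewrite subr_ge0.
have := mulr_ge0 h ab0.
have : 0 <= (b `^ (p - 1) - M `^ (p - 1)) * (b - a) ^+ 2.
  by rewrite mulr_ge0 ?sqr_ge0// subr_ge0.
by move=> *; nra.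
Qed.

Lemma is_derive_psi p x : 0 < x -> is_derive x 1 (psi p) (x `^ (p - 1)).
Proof.
move=> x0; rewrite /psi; have [->|pn0] := eqVneq p 0.
  by rewrite sub0r powR_inv1 ?ltW//; exact: is_derive1_ln.
have ? := is_derive1_powR p x0.
rewrite (_ : (fun y => _) = fun y => p^-1 * (y `^ p - 1)); last first.
  by apply/funext => y; rewrite mulrC.
apply: is_derive_eq.
by rewrite /GRing.scale/= subr0 mulrA mulVf// mul1r.
Qed.

(** The left side is the tangent plane of [theta p] at [(a0, b0)]: this is joint convexity. *)
Lemma theta_subgradient p a0 b0 a b : 0 <= p <= 1 ->
  0 < a0 -> 0 < b0 -> 0 < a -> 0 < b ->
  (a - b) * (psi p a0 - psi p b0) +
    (a0 - b0) * (a0 `^ (p - 1) * (a - a0) - b0 `^ (p - 1) * (b - b0))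
  <= theta p a b.
Proof.
(* Both sides are integrals over t \in [0, 1] along the segments m and m0: the
   left side of the linearization at (a0 - b0, m0 t) of u ^+ 2 * x `^ (p - 1),
   which is convex in (u, x), the right side of its value at (a - b, m t). *)
move=> p01 a00 b00 a_gt0 b_gt0.
pose m t : R := b + t * (a - b); pose m0 t : R := b0 + t * (a0 - b0).
(* Chosen so that [F 1 - F 0] is the right side minus the left side; the mean value theorem then
   only needs [dF] to be nonnegative. *)
pose F t : R := (a - b) * ((psi p \o m) t - (psi p \o m0) t) -
  (a0 - b0) * (((@powR R ^~ (p - 1)) \o m0) t * (m t - m0 t)).
pose dF t : R :=
  (a - b) * (m t `^ (p - 1) * (a - b) - m0 t `^ (p - 1) * (a0 - b0)) -
  (a0 - b0) * ((p - 1) * m0 t `^ (p - 1 - 1) * (a0 - b0) * (m t - m0 t) +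
   m0 t `^ (p - 1) * ((a - b) - (a0 - b0))).
have conv_gt0 (u v t : R) : 0 < u -> 0 < v -> 0 <= t <= 1 ->
    0 < v + t * (u - v).
  by move=> ? ? /andP[? ?]; nra.
have dFP (t : R) : 0 <= t <= 1 -> is_derive t 1 F (dF t).
  move=> t01.
  have dm : is_derive t 1 m (a - b).
    by rewrite /m; apply: is_derive_eq; rewrite /GRing.scale/=; ring.
  have dm0 : is_derive t 1 m0 (a0 - b0).
    by rewrite /m0; apply: is_derive_eq; rewrite /GRing.scale/=; ring.
  have mt0 : 0 < m t by exact: conv_gt0.
  have m0t0 : 0 < m0 t by exact: conv_gt0.
  have d1 : is_derive t 1 (psi p \o m) (m t `^ (p - 1) * (a - b)).
    by have ? := @is_derive_psi p _ mt0; apply: is_derive1_comp.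
  have d2 : is_derive t 1 (psi p \o m0) (m0 t `^ (p - 1) * (a0 - b0)).
    by have ? := @is_derive_psi p _ m0t0; apply: is_derive1_comp.
  have d3 : is_derive t 1 ((@powR R ^~ (p - 1)) \o m0)
      ((p - 1) * m0 t `^ (p - 1 - 1) * (a0 - b0)).
    by have ? := is_derive1_powR (p - 1) m0t0; apply: is_derive1_comp.
  rewrite /F.
  apply: is_derive_eq.
  by rewrite /dF /GRing.scale/=; ring.
have dF_ge0 t : 0 <= t <= 1 -> 0 <= dF t.
  move=> t01; rewrite /dF.
  have : 0 < m t by exact: conv_gt0.
  have : 0 < m0 t by exact: conv_gt0.
  move: (m t) (m0 t) (a - b) (a0 - b0) => x x0 u u0 x0_gt0 x_gt0.
  have /andP[p0 p1] := p01.
  have p01' : 0 <= 1 - p <= 1 by apply/andP; split; lra.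
  have gk : x `^ (p - 1) * x `^ (1 - p) = 1.
    by rewrite -(opprB p) powRN divff// gt_eqF// powR_gt0.
  have ql : x0 `^ (p - 1) * x0 `^ (1 - p) = 1.
    by rewrite -(opprB p) powRN divff// gt_eqF// powR_gt0.
  have qr := mulr_powRB1_gt0 (p - 1) x0_gt0.
  (* Concavity of the power with exponent [1 - p], that is, its tangent inequality at 1 evaluated at
     [x / x0]. *)
  have k_le : x `^ (1 - p) * x0 <= x0 `^ (1 - p) * (x0 + (1 - p) * (x - x0)).
    have := powR_le_tangent1 p01' (divr_gt0 x_gt0 x0_gt0).
    rewrite -(ler_pM2l (powR_gt0 (1 - p) x0_gt0)) -(ler_pM2r x0_gt0).
    rewrite -powRM ?divr_ge0 ?(ltW x0_gt0) ?(ltW x_gt0)// mulrC.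
    rewrite [x0 * (x / x0)]mulrC divfK ?gt_eqF// mulrC => /le_trans; apply.
    rewrite le_eqVlt; apply/orP; left; apply/eqP; field.
    by rewrite gt_eqF.
  move: (powR_gt0 (p - 1) x_gt0) (powR_gt0 (p - 1) x0_gt0)
    (powR_gt0 (p - 1 - 1) x0_gt0) gk ql qr k_le.
  set g := x `^ (p - 1); set k := x `^ (1 - p); set q := x0 `^ (p - 1).
  set l := x0 `^ (1 - p); set r := x0 `^ _ => g0 q0 r0 gk ql qr k_le.
  have le1 : q ^+ 2 * k <= q + (1 - p) * r * (x - x0).
    have := ler_wpM2l (ltW (mulr_gt0 q0 r0)) k_le.
    have -> : q * r * (k * x0) = q * (x0 * r) * k by ring.
    rewrite qr -expr2.
    have -> : q * r * (l * (x0 + (1 - p) * (x - x0))) =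
      (q * l) * (x0 * r + (1 - p) * r * (x - x0)) by ring.
    by rewrite ql qr mul1r.
  have le2 := ler_wpM2l (sqr_ge0 u0) le1.
  (* Completion of the square: [le2] bounds the last term of [dF t] from below, and what remains is
     this square, since [g * k = 1]. *)
  have : 0 <= g * (u - u0 * q * k) ^+ 2 by rewrite mulr_ge0 ?sqr_ge0// ltW.
  have -> : g * (u - u0 * q * k) ^+ 2 =
    g * u ^+ 2 - 2 * u * u0 * q * (g * k) + u0 ^+ 2 * (q ^+ 2 * k) * (g * k).
    by ring.
  by rewrite gk => le3; lra.
have cF : {within `[0, 1], continuous F}.
  apply: derivable_within_continuous => t; rewrite in_itv/= => t01.
  by have [] := dFP t t01.
have dF' (t : R) : t \in `]0, 1[ -> is_derive t 1 F (dF t).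
  by rewrite in_itv/= => /andP[t0 t1]; apply: dFP; rewrite !ltW.
have [c] := MVT_segment ler01 dF' cF.
rewrite in_itv/= => c01 F10.
have : 0 <= F 1 - F 0 by rewrite F10 mulr_ge0// ?subr0// dF_ge0.
rewrite /F /m /m0 /theta /= !mul1r !mul0r !addr0 ![_ + (_ - _)]addrC !subrK.
move=> h.
by lra.
Qed.

End psi.

(** * Contraction of the Fisher information by coupling *)

Section coupling.
Variables (R : realFieldType) (T G : finType).
Variables (act : G -> T -> T) (stays : G -> T -> bool) (inv : G -> G).
Variables (c w : T -> G -> R).
Implicit Types (i k : T) (g s : G).

Definition transverse s g := (g != s) && (g != inv s).

Hypothesis invK : involutive inv.
Hypothesis inv_neq : forall g, inv g != g.
Hypothesis stays_inv : forall g i, stays g i -> stays (inv g) (act g i).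
Hypothesis actK : forall g i, stays g i -> act (inv g) (act g i) = i.
Hypothesis stays_act : forall s g i, transverse s g -> stays s i ->
  stays g (act s i) = stays g i.
Hypothesis actC : forall s g i, transverse s g -> stays s i -> stays g i ->
  act g (act s i) = act s (act g i).
Hypothesis c_ge0 : forall i g, 0 <= c i g.
Hypothesis c_nstays : forall i g, ~~ stays g i -> c i g = 0.
(** [w] is the weight of an edge in the Dirichlet form. [w_inv] is detailed balance, and [w_c_act]
    says that the rates multiply to the same value along the two paths across a square. *)
Hypothesis w_ge0 : forall i g, 0 <= w i g.
Hypothesis w_nstays : forall i g, ~~ stays g i -> w i g = 0.
Hypothesis w_inv : forall i g, stays g i -> w (act g i) (inv g) = w i g.
Hypothesis w_c : forall i s g, w i s * c i g = w i g * c i s.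
Hypothesis w_c_act : forall i s g, transverse s g -> stays s i -> stays g i ->
  w i s * c (act s i) g = w i g * c (act g i) s.

(** Reindexing by the involution that reverses an edge and fixes the pairs that are not edges. *)
Lemma sum_flip (F : T -> G -> R) :
  (forall i g, ~~ stays g i -> F i g = 0) ->
  \sum_i \sum_g F i g =
  \sum_i \sum_g (if stays g i then F (act g i) (inv g) else 0).
Proof.
move=> F0; pose flip (e : T * G) :=
  if stays e.2 e.1 then (act e.2 e.1, inv e.2) else e.
have flipK : involutive flip.
  move=> [i g]; rewrite {2}/flip/=; case: ifPn => [si|/negbTE si].
    by rewrite /flip/= stays_inv// actK// invK.
  by rewrite /flip/= si.
rewrite !pair_bigA/= (reindex_inj (inv_inj flipK))/=.
apply: eq_bigr => -[i g] _; rewrite /flip/=; case: ifPn => //= si.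
exact: F0.
Qed.

Lemma sum_flip0 (F : T -> G -> R) :
  (forall i g, ~~ stays g i -> F i g = 0) ->
  (forall i g, stays g i -> F (act g i) (inv g) = - F i g) ->
  \sum_i \sum_g F i g = 0.
Proof.
move=> F0 Finv; have := sum_flip F0; set S := LHS => SE.
suff : S = - S by move=> /eqP; rewrite -addr_eq0 -mulr2n mulrn_eq0 => /eqP.
rewrite {1}SE /S -sumrN; apply: eq_bigr => i _; rewrite -sumrN.
by apply: eq_bigr => g _; case: ifPn => [/Finv//|/F0 ->]; rewrite oppr0.
Qed.

Lemma transverseC s g : transverse s g = transverse g s.
Proof.
rewrite /transverse eq_sym; congr (_ && ~~ _).
by apply/eqP/eqP => ->; rewrite invK.
Qed.

Lemma transverse_invl s g : transverse (inv s) g = transverse s g.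
Proof. by rewrite /transverse invK andbC. Qed.

Lemma transverse_invr s g : transverse s (inv g) = transverse s g.
Proof. by rewrite transverseC transverse_invl transverseC. Qed.

Definition pos_part (x : R) := Num.max x 0.

(* The rate at which the coupled chains meet because the one at i jumps to the
   other one, at act s i. *)
Definition edge_curv i s := c i s - c (act s i) s -
  \sum_(g | transverse s g) pos_part (c (act s i) g - c i g).

(** * Reversibility of the coupled edge process *)

Section generator.
Variable th : T -> G -> R.
Hypothesis th_inv : forall i g, stays g i -> th (act g i) (inv g) = th i g.

(* The generator of the coupling of the chains started at i and at k = act s i,
   without the jumps that make them meet. A transverse move is made by both
   chains at the common part of its two rates; the excess of the rate at i is
   paired with the jump of the other chain from k to i, and vice versa. When one
   of the chains moves away along the edge, the other one follows it. *)
Definition coupled i s : R :=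
  \sum_(g | transverse s g)
    (Num.min (c i g) (c (act s i) g) * (th (act g i) s - th i s)
     + pos_part (c i g - c (act s i) g) * (th i g - th i s)
     + pos_part (c (act s i) g - c i g) * (th (act s i) g - th i s))
  + c (act s i) s * (th (act s i) s - th i s)
  + c i (inv s) * (th i (inv s) - th i s).

(** For fixed [s], reversing the move [g] exchanges the two weighted rates under the minimum, so the
    coupled rate is unchanged while the increment of [th] changes sign. *)
Let sum_parallel : \sum_i \sum_s w i s * (\sum_(g | transverse s g)
  Num.min (c i g) (c (act s i) g) * (th (act g i) s - th i s)) = 0.
Proof.
rewrite exchange_big/= big1// => s _.
pose F i g := if transverse s g then
  w i s * (Num.min (c i g) (c (act s i) g) * (th (act g i) s - th i s)) else 0.
rewrite -[RHS](@sum_flip0 F) => [|i g si|i g gi].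
- apply: eq_bigr => i _; rewrite mulr_sumr big_mkcond; exact: eq_bigr.
- rewrite /F; case: ifP => // sg; have [ssi|/w_nstays->] := boolP (stays s i).
    by rewrite !c_nstays ?stays_act// minxx !mul0r mulr0.
  by rewrite mul0r.
rewrite /F transverse_invr; case: ifP => sg; last by rewrite oppr0.
have gs : transverse g s by rewrite transverseC.
have [si|nsi] := boolP (stays s i); last first.
  by rewrite !(w_nstays nsi) w_nstays ?stays_act// !mul0r oppr0.
rewrite actK// !mulrA !minr_pMr// -mulNr.
have -> : w (act g i) s * c (act g i) (inv g) = w i s * c (act s i) g.
  by rewrite w_c w_inv// w_c_act.
have -> : w (act g i) s * c (act s (act g i)) (inv g) = w i s * c i g.
  have ssg : stays s (act g i) by rewrite stays_act.
  rewrite (@w_c_act _ _ (inv g)) ?transverse_invr ?stays_inv//.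
  by rewrite w_inv// actK// w_c.
by rewrite minC mulNr -mulrN opprB.
Qed.

(** For fixed [i], the weighted excess rate is symmetric in [s] and [g] by [w_c] and [w_c_act],
    while the increment is antisymmetric. *)
Let sum_turn : \sum_i \sum_s w i s * (\sum_(g | transverse s g)
  pos_part (c i g - c (act s i) g) * (th i g - th i s)) = 0.
Proof.
rewrite big1// => i _.
pose F s g := if transverse s g then
  w i s * (pos_part (c i g - c (act s i) g) * (th i g - th i s)) else 0.
have FE : \sum_s w i s * (\sum_(g | transverse s g)
    pos_part (c i g - c (act s i) g) * (th i g - th i s)) =
    \sum_s \sum_g F s g.
  by apply: eq_bigr => s _; rewrite mulr_sumr big_mkcond.
rewrite FE; set S := LHS.
suff : S = - S by move=> /eqP; rewrite -addr_eq0 -mulr2n mulrn_eq0 => /eqP.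
rewrite {1}/S exchange_big/= -sumrN; apply: eq_bigr => s _.
rewrite -sumrN; apply: eq_bigr => g _; rewrite /F transverseC.
case: ifP => sg; last by rewrite oppr0.
have [si|nsi] := boolP (stays s i); have [gi|ngi] := boolP (stays g i).
- rewrite !mulrA /pos_part !maxr_pMr// !mulr0.
  rewrite (mulrBr (w i g)) (mulrBr (w i s)).
  by rewrite (w_c i g s) -(w_c_act sg si gi) -[RHS]mulrN opprB.
- rewrite (w_nstays ngi) (c_nstays ngi) (@c_nstays (act s i) g) ?stays_act//.
  by rewrite subrr /pos_part maxxx mul0r mul0r mulr0 oppr0.
- rewrite (w_nstays nsi) (c_nstays nsi) (@c_nstays (act g i) s).
    by rewrite subrr /pos_part maxxx !mul0r mulr0 oppr0.
  by rewrite stays_act// transverseC.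
- by rewrite !w_nstays// !mul0r oppr0.
Qed.

(** The sum of [sum_turn], seen from the other endpoint of the edge. *)
Let sum_turn_back : \sum_i \sum_s w i s * (\sum_(g | transverse s g)
  pos_part (c (act s i) g - c i g) * (th (act s i) g - th i s)) = 0.
Proof.
rewrite sum_flip => [|i s /w_nstays->]; last by rewrite mul0r.
rewrite -[RHS]sum_turn; apply: eq_bigr => i _; apply: eq_bigr => s _.
case: ifPn => [si|/w_nstays->]; last by rewrite mul0r.
rewrite w_inv//; congr (_ * _); apply: eq_big => g.
  by rewrite transverse_invl.
by move=> _; rewrite actK// th_inv.
Qed.

(** Exchanging [s] and [inv s] preserves the weighted rate by [w_c] and changes the sign of the
    increment; [sum_forward] is the same sum after reversal of the edges. *)
Let sum_backward :
  \sum_i \sum_s w i s * (c i (inv s) * (th i (inv s) - th i s)) = 0.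
Proof.
rewrite big1// => i _; set S := LHS.
suff : S = - S by move=> /eqP; rewrite -addr_eq0 -mulr2n mulrn_eq0 => /eqP.
rewrite {1}/S (reindex_inj (inv_inj invK))/= -sumrN; apply: eq_bigr => s _.
by rewrite invK mulrA w_c -mulrA -mulrN -mulrN opprB.
Qed.

Let sum_forward :
  \sum_i \sum_s w i s * (c (act s i) s * (th (act s i) s - th i s)) = 0.
Proof.
rewrite sum_flip => [|i s /w_nstays->]; last by rewrite mul0r.
rewrite -[RHS]sum_backward; apply: eq_bigr => i _; apply: eq_bigr => s _.
case: ifPn => [si|/w_nstays->]; last by rewrite mul0r.
by rewrite w_inv// actK// th_inv.
Qed.

(** The weight [w] is invariant under the coupled generator, because each of its five kinds of jumps
    is balanced separately. *)
Lemma sum_coupled : \sum_i \sum_s w i s * coupled i s = 0.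
Proof.
rewrite -[RHS]addr0 -[X in _ = X + _]sum_parallel -[X in _ = _ + X]addr0.
rewrite -[X in _ = _ + (X + _)]sum_turn -[X in _ = _ + (_ + X)]addr0.
rewrite -[X in _ = _ + (_ + (X + _))]sum_turn_back.
rewrite -[X in _ = _ + (_ + (_ + X))]addr0.
rewrite -[X in _ = _ + (_ + (_ + (X + _)))]sum_forward.
rewrite -[X in _ = _ + (_ + (_ + (_ + X)))]sum_backward.
rewrite -!big_split/=; apply: eq_bigr => i _.
rewrite -!big_split/=; apply: eq_bigr => s _.
by rewrite /coupled !big_split/= !mulrDr !addrA.
Qed.

End generator.

(** * Contraction of a convex edge functional in one step of the chain *)

Section contraction.
Variables (th : R -> R -> R) (t : R) (f : T -> R).
Hypothesis thC : forall x y : R, th x y = th y x.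
Hypothesis thxx : forall x : R, th x x = 0.
Hypothesis th_ge0 : forall x y : R, 0 < x -> 0 < y -> 0 <= th x y.
Hypothesis th_subgradient : forall x0 y0 : R, 0 < x0 -> 0 < y0 ->
  exists A B C : R,
  A * x0 + B * y0 + C = th x0 y0 /\
  forall x y : R, 0 < x -> 0 < y -> A * x + B * y + C <= th x y.
Hypothesis t_ge0 : 0 <= t.
Hypothesis t_le : forall i, t * \sum_g c i g <= 2^-1.
Hypothesis edge_curv_ge0 : forall i s, stays s i -> 0 <= edge_curv i s.
Hypothesis f_gt0 : forall i, 0 < f i.

Definition chain_step i := f i + t * \sum_g c i g * (f (act g i) - f i).
Hypothesis chain_step_gt0 : forall i, 0 < chain_step i.

Let the i g := th (f i) (f (act g i)).

(** The affine minorant of [th] that is exact at the new pair of values can be averaged over the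
    coupled jumps, since it is affine; after each jump it is at most [th]. The jumps that make the
    chains meet contribute at most 0, because [th x x = 0]. *)
Lemma coupling_step i s : stays s i ->
  th (chain_step i) (chain_step (act s i)) <=
  (1 - t * (edge_curv i s + edge_curv (act s i) (inv s))) * the i s +
  t * coupled the i s.
Proof.
move=> si; set k := act s i.
have [A [B [C [<- thL]]]] :=
  th_subgradient (chain_step_gt0 i) (chain_step_gt0 k).
set E0 := A * f i + B * f k + C.
have E0_le : E0 <= the i s by exact: thL.
pose rc := \sum_(g | transverse s g)
  (Num.min (c i g) (c k g)
   + pos_part (c i g - c k g) + pos_part (c k g - c i g)).
pose Si := \sum_(g | transverse s g) pos_part (c k g - c i g).
pose Sk := \sum_(g | transverse s g) pos_part (c i g - c k g).
pose Q := \sum_(g | transverse s g)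
  (Num.min (c i g) (c k g) * th (f (act g i)) (f (act g k))
     + pos_part (c i g - c k g) * the i g + pos_part (c k g - c i g) * the k g).
have kiE : edge_curv i s = c i s - c k s - Si by [].
have kkE : edge_curv k (inv s) = c k (inv s) - c i (inv s) - Sk.
  rewrite /edge_curv /k actK//; congr (_ - _); apply: eq_bigl => g.
  exact: transverse_invl.
have coupledE : coupled the i s = Q - rc * the i s
    + c k s * (the k s - the i s) + c i (inv s) * (the i (inv s) - the i s).
  rewrite /coupled -/k; congr (_ + _ + _).
  rewrite mulr_suml -sumrB; apply: eq_bigr => g sg.
  have [gi|gi] := boolP (stays g i).
    by rewrite {1}/the -actC// -/k; ring.
  rewrite !c_nstays ?stays_act// subrr minxx /pos_part maxxx; ring.
have split_moves (F : G -> R) : \sum_g F g =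
    F s + F (inv s) + \sum_(g | transverse s g) F g.
  rewrite (bigD1 s)//= (bigD1 (inv s)) ?inv_neq//= addrA.
  by congr (_ + _).
have drift : A * \sum_g c i g * (f (act g i) - f i) +
    B * \sum_g c k g * (f (act g k) - f k) <=
  Q - rc * E0 + c k s * (the k s - E0) + c i (inv s) * (the i (inv s) - E0)
  + (edge_curv i s + edge_curv k (inv s)) * - E0.
  rewrite !split_moves -/k (_ : act (inv s) k = i) ?actK//.
  pose delta := f k - f i.
  (* The corrections in [delta] stand for the jumps along the edge that are paired with the excess
     moves; their rates [Si] and [Sk] are taken from [c i s] and [c k (inv s)]. *)
  have cross : A * \sum_(g | transverse s g) c i g * (f (act g i) - f i) +
      B * \sum_(g | transverse s g) c k g * (f (act g k) - f k) <=
      Q - rc * E0 + Sk * (B * delta) - Si * (A * delta).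
    rewrite !mulr_sumr -big_split/= /Q /rc /Sk /Si !mulr_suml.
    rewrite -!sumrB -big_split/= -sumrB.
    apply: ler_sum => g sg.
    have [gi|gi] := boolP (stays g i); last first.
      rewrite !c_nstays ?stays_act// subrr minxx /pos_part maxxx; lra.
    have th1 := thL _ _ (f_gt0 (act g i)) (f_gt0 (act g k)).
    have th2 : A * f (act g i) + B * f i + C <= the i g.
      by rewrite /the thC; have := thL _ _ (f_gt0 (act g i)) (f_gt0 i).
    have th3 := thL _ _ (f_gt0 k) (f_gt0 (act g k)).
    have := c_ge0 i g; have := c_ge0 k g.
    rewrite /pos_part /delta /E0 -/(the k g).
    move: (c i g) (c k g) => u v v0 u0; rewrite -/(the k g) in th3.
    have [uv|vu] := leP u v.
      rewrite max_r ?max_l ?subr_ge0 ?subr_le0//.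
      have := ler_wpM2l u0 th1.
      have vu0 : 0 <= v - u by rewrite subr_ge0.
      by have := ler_wpM2l vu0 th3; move=> ? ?; lra.
    rewrite max_l ?max_r ?subr_ge0 ?subr_le0 ?(ltW vu)//.
    have := ler_wpM2l v0 th1.
    have uv0 : 0 <= u - v by rewrite subr_ge0 ltW.
    by have := ler_wpM2l uv0 th2; move=> ? ?; lra.
  have fwd : c k s * (A * f k + B * f (act s k) + C) <= c k s * the k s.
    by rewrite ler_wpM2l// thL.
  have bwd : c i (inv s) * (A * f (act (inv s) i) + B * f i + C) <=
      c i (inv s) * the i (inv s).
    by rewrite ler_wpM2l// /the thC thL.
  (* Both chains meet at [k], at the part of the rate [c i s] that is used neither for following a
     forward move nor for the excess moves. *)
  have diag_k : edge_curv i s * (A * f k + B * f k + C) <= 0.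
    by rewrite mulr_ge0_le0 ?edge_curv_ge0// -(thxx (f k)) thL.
  have diag_i : edge_curv k (inv s) * (A * f i + B * f i + C) <= 0.
    by rewrite mulr_ge0_le0 ?edge_curv_ge0 ?stays_inv// -(thxx (f i)) thL.
  rewrite kiE in diag_k *; rewrite kkE in diag_i *.
  move: cross fwd bwd diag_k diag_i; rewrite /delta /E0.
  move: (\sum_(g | _) c i g * _) (\sum_(g | _) c k g * _) => Di Dk.
  by move=> *; lra.
(* The total rate of the coupling. It is at most the sum of the total rates at [i] and [k], each at
   most one half after multiplication by [t]; hence [E0] has a nonnegative coefficient and can be
   replaced by [the i s]. *)
pose out := rc + c k s + c i (inv s) + edge_curv i s + edge_curv k (inv s).
have out_le : t * out <= 1.
  have rcE : rc - Si - Sk = \sum_(g | transverse s g) Num.min (c i g) (c k g).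
    by rewrite /rc /Si /Sk -!sumrB; apply: eq_bigr => g _; ring.
  have min_le : rc - Si - Sk <= \sum_(g | transverse s g) c i g.
    by rewrite rcE; apply: ler_sum => g _; rewrite ge_min lexx.
  have ck_ge0 : 0 <= c k s + \sum_(g | transverse s g) c k g.
    by rewrite addr_ge0// sumr_ge0.
  have cis_ge0 := c_ge0 i (inv s).
  have := t_le i; have := t_le k; rewrite /out !split_moves kiE kkE.
  move=> tk ti.
  apply: (@le_trans _ _
    (t * (c i s + c i (inv s) + \sum_(g | transverse s g) c i g)
     + t * (c k s + c k (inv s) + \sum_(g | transverse s g) c k g))); last first.
    by lra.
  by rewrite -mulrDr ler_wpM2l//; lra.
have -> : A * chain_step i + B * chain_step k + C =
  E0 + t * (A * \sum_g c i g * (f (act g i) - f i) +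
            B * \sum_g c k g * (f (act g k) - f k)).
  by rewrite /chain_step /E0; ring.
rewrite coupledE.
have := ler_wpM2l t_ge0 drift.
have := ler_wpM2l (_ : 0 <= 1 - t * out) E0_le.
rewrite subr_ge0 => /(_ out_le); rewrite /out.
by move=> *; lra.
Qed.

(** The weighted sum of [coupling_step]: the generator part vanishes by [sum_coupled] and only the
    rate of meeting remains. *)
Lemma dirichlet_contraction a :
  (forall i s, stays s i -> a <= edge_curv i s + edge_curv (act s i) (inv s)) ->
  \sum_i \sum_s w i s * th (chain_step i) (chain_step (act s i)) <=
  (1 - t * a) * \sum_i \sum_s w i s * the i s.
Proof.
move=> a_le; have th_inv i s : stays s i -> the (act s i) (inv s) = the i s.
  by move=> si; rewrite /the actK.
have -> : (1 - t * a) * \sum_i \sum_s w i s * the i s =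
    (1 - t * a) * (\sum_i \sum_s w i s * the i s) +
    t * \sum_i \sum_s w i s * coupled the i s.
  by rewrite (sum_coupled th_inv) mulr0 addr0.
rewrite [X in X + _]mulr_sumr [X in _ + X]mulr_sumr -big_split/=.
apply: ler_sum => i _.
rewrite !mulr_sumr -big_split/=; apply: ler_sum => s _.
have [si|/w_nstays->] := boolP (stays s i); last by rewrite !mul0r !mulr0 addr0.
have := ler_wpM2l (w_ge0 i s) (coupling_step si).
move=> /le_trans; apply; rewrite mulrDr mulrCA [w i s * (t * _)]mulrCA lerD2r.
rewrite ler_wpM2r ?mulr_ge0// ?th_ge0//.
by rewrite lerD2l lerN2 ler_wpM2l// a_le.
Qed.

End contraction.

End coupling.

(** * Double sums of nonnegative terms *)

Lemma le_sum_term (R : numDomainType) (I J : finType) (F : I -> J -> R) :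
  (forall i j, 0 <= F i j) -> forall i j, F i j <= \sum_i \sum_j F i j.
Proof.
move=> F0 i j; rewrite (bigD1 i)//= (bigD1 j)//= -addrA lerDl.
by rewrite addr_ge0// sumr_ge0// => k _; rewrite sumr_ge0.
Qed.

Lemma sum_pinfty (R : realDomainType) (I J : finType) (F : I -> J -> \bar R)
    i j :
  (forall i j, 0 <= F i j)%E -> F i j = +oo%E ->
  (\sum_i \sum_j F i j = +oo)%E.
Proof.
move=> F0 Fij; have ge0_neqNy (x : \bar R) : (0 <= x)%E -> x != -oo%E.
  by move=> x0; rewrite gt_eqF// (lt_le_trans ltNy0).
rewrite (bigD1 i)//= (bigD1 j)//= Fij !addye// ge0_neqNy// sume_ge0// => k _.
by rewrite sume_ge0.
Qed.

(** * The grid *)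

Section moves.
Variables (R : realType) (d N : nat) (K h : R).
Hypothesis h_gt0 : 0 < h.
Implicit Types (i k : grid d N) (g : moves d) (x : 'rV[R]_d).

Definition opp_move g : moves d := (g.1, ~~ g.2).

Lemma opp_moveK : involutive opp_move.
Proof. by case=> j b; rewrite /opp_move/= negbK. Qed.

Lemma opp_move_neq g : opp_move g != g.
Proof. by case: g => j [] /=; rewrite /opp_move xpair_eqE eqxx. Qed.

Lemma transverse_coord g g' : transverse opp_move g g' = (g'.1 != g.1).
Proof.
case: g g' => j b [j' b']; rewrite /transverse /opp_move !xpair_eqE /=.
by case: eqVneq => //= _; case: b b' => [] [].
Qed.

Lemma shiftK g x : Defs.shift h (opp_move g) (Defs.shift h g x) = x.
Proof. by rewrite /Defs.shift/=; case: g.2 => /=; rewrite ?addrK ?subrK. Qed.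

Lemma shiftC g g' x :
  Defs.shift h g (Defs.shift h g' x) = Defs.shift h g' (Defs.shift h g x).
Proof. by rewrite /Defs.shift; case: g.2; case: g'.2; rewrite addrAC. Qed.

Lemma pt_inj : injective (@pt R d N K h).
Proof.
move=> i k /rowP ik; apply/ffunP => j; apply/val_inj; have := ik j.
rewrite !mxE => /addIr/addrI/(mulfI (lt0r_neq0 h_gt0))/eqP.
by rewrite eqr_nat eqSS => /eqP.
Qed.

Lemma pt_act g i : stays K h g i ->
  pt K h (act K h g i) = Defs.shift h g (pt K h i).
Proof.
rewrite /stays /act => /existsP[k kP]; case: pickP => [k' /eqP//|/(_ k)].
by rewrite kP.
Qed.

Lemma act_eq g i k : pt K h k = Defs.shift h g (pt K h i) ->
  stays K h g i /\ act K h g i = k.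
Proof.
move=> kP; have si : stays K h g i by apply/existsP; exists k; rewrite kP.
by split => //; apply: pt_inj; rewrite pt_act.
Qed.

Lemma act_nstays g i : ~~ stays K h g i -> act K h g i = i.
Proof.
rewrite /stays negb_exists => /forallP si; rewrite /act; case: pickP => // k.
by rewrite (negbTE (si k)).
Qed.

Lemma act_opp g i : stays K h g i ->
  stays K h (opp_move g) (act K h g i) /\
  act K h (opp_move g) (act K h g i) = i.
Proof. by move=> si; apply: act_eq; rewrite pt_act// shiftK. Qed.

Lemma stays_opp g i : stays K h g i -> stays K h (opp_move g) (act K h g i).
Proof. by case/act_opp. Qed.

Lemma actK g i : stays K h g i -> act K h (opp_move g) (act K h g i) = i.
Proof. by case/act_opp. Qed.

(** Turns equations between real grid points into equations between integer indices, from which all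
    boundary conditions are read off. *)
Lemma pt_shift_plusP i k j : pt K h k = Defs.shift h (j, true) (pt K h i) <->
  (forall l, k l = (i l + (l == j))%N :> nat).
Proof.
have E l : Defs.shift h (j, true) (pt K h i) 0 l =
    - K + h * (i l + (l == j)).+1%:R - h / 2.
  by rewrite /Defs.shift/= !mxE eqxx/= -addSn natrD mulrDr; ring.
split => [/rowP kP l|kP].
  have := kP l; rewrite E mxE => /addIr/addrI/(mulfI (lt0r_neq0 h_gt0))/eqP.
  by rewrite eqr_nat eqSS => /eqP.
by apply/rowP => l; rewrite E mxE kP.
Qed.

Lemma pt_shift_minusP i k j : pt K h k = Defs.shift h (j, false) (pt K h i) <->
  (forall l, i l = (k l + (l == j))%N :> nat).
Proof.
rewrite -pt_shift_plusP; split => [->|->].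
  by rewrite (shiftK (j, false)).
by rewrite (shiftK (j, true)).
Qed.

Lemma staysE g i :
  stays K h g i = if g.2 then ((i g.1).+1 < N)%N else (0 < i g.1)%N.
Proof.
apply/existsP/idP => [[k /eqP]|].
  case: g => j [] /=; rewrite ?pt_shift_plusP ?pt_shift_minusP => /(_ j).
    by rewrite eqxx addn1 => <-.
  by rewrite eqxx addn1 => ->.
case: g => j [] /= ij.
  exists [ffun l => if l == j then Ordinal ij else i l]; apply/eqP.
  apply/pt_shift_plusP => l; rewrite ffunE.
  by case: eqVneq => [->|]; rewrite ?addn1 ?addn0.
have ij' : ((i j).-1 < N)%N by rewrite (leq_ltn_trans (leq_pred _)).
exists [ffun l => if l == j then Ordinal ij' else i l]; apply/eqP.
apply/pt_shift_minusP => l; rewrite ffunE.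
case: eqVneq => [->|]; rewrite ?addn0//=.
by rewrite addn1 prednK.
Qed.

Lemma act_coord g i l : l != g.1 -> act K h g i l = i l.
Proof.
move=> lg; have [si|/act_nstays->//] := boolP (stays K h g i).
apply/val_inj; have := pt_act si.
case: g lg {si} => j [] /= /negbTE lj.
  by move/pt_shift_plusP/(_ l); rewrite lj addn0.
by move/pt_shift_minusP/(_ l); rewrite lj addn0.
Qed.

Lemma stays_act g g' i : g'.1 != g.1 ->
  stays K h g' (act K h g i) = stays K h g' i.
Proof. by move=> gg'; rewrite !staysE act_coord. Qed.

Lemma actC g g' i : g'.1 != g.1 -> stays K h g i -> stays K h g' i ->
  act K h g' (act K h g i) = act K h g (act K h g' i).
Proof.
move=> gg' si si'; apply: pt_inj.
by rewrite !pt_act ?stays_act ?(eq_sym g.1)// shiftC.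
Qed.

Lemma act_coord1 g i : stays K h g i ->
  act K h g i g.1 = (if g.2 then (i g.1).+1 else (i g.1).-1) :> nat.
Proof.
move=> /pt_act; case: g => j [] /=.
  by move/pt_shift_plusP/(_ j); rewrite eqxx addn1.
by move/pt_shift_minusP/(_ j); rewrite eqxx addn1 => ->.
Qed.

(** Quantitative connectedness of the grid, by induction on the distance to [k]. *)
Lemma edges_connect (f : grid d N -> R) eta : 0 <= eta ->
  (forall i g, stays K h g i -> `|f i - f (act K h g i)| <= eta) ->
  forall i k, `|f i - f k| <= (d * N)%:R * eta.
Proof.
(* [D] is the l1 distance to [k]: one of the two truncated differences is always 0. *)
move=> eta0 fe i k; pose D i := (\sum_l ((i l - k l) + (k l - i l)))%N.
have : (D i <= d * N)%N.
  rewrite /D -[d in (d * N)%N]card_ord -sum_nat_const leq_sum// => l _.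
  by have := ltn_ord (i l); have := ltn_ord (k l); lia.
elim: (d * N)%N i => [|n IHn] i Di.
  have [->|] := eqVneq i k; first by rewrite subrr normr0 mul0r.
  move/eqP => ik; exfalso; apply: ik; apply/ffunP => l; apply/val_inj => /=.
  by move: Di; rewrite /D (bigD1 l)//=; lia.
have [->|ik] := eqVneq i k; first by rewrite subrr normr0 mulr_ge0.
have [l ikl] : exists l, i l != k l.
  apply/existsP; rewrite -negb_forall; apply: contra ik => /forallP ik.
  by apply/eqP/ffunP => l; apply/eqP.
have {}ikl : i l <> k l :> nat by move/val_inj/eqP; apply/negP.
(* The move in direction [l] that points towards [k], hence stays in the grid. *)
pose g : moves d := (l, (i l < k l)%N).
have si : stays K h g i.
  rewrite staysE /=; have := ltn_ord (k l); have := ltn_ord (i l).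
  by case: (ltnP (i l) (k l)) => /=; lia.
have Dact : (D (act K h g i) < D i)%N.
  rewrite /D (bigD1 l)// [ltnRHS](bigD1 l)//=.
  rewrite (eq_bigr (fun l => (i l - k l) + (k l - i l))%N); last first.
    by move=> l' ll'; rewrite act_coord.
  rewrite ltn_add2r (act_coord1 si)/=; case: (ltnP (i l) (k l)); lia.
rewrite -(subrKA (f (act K h g i))) (le_trans (ler_normD _ _))//.
rewrite -natr1 mulrDl mul1r addrC lerD ?fe//.
by apply: IHn; rewrite -ltnS (leq_trans Dact).
Qed.

End moves.

(** * The chain *)

Section chain.
Variables (R : realType) (d N : nat) (K h sigma : R) (V : 'rV[R]_d -> R).
Hypotheses (h_gt0 : 0 < h) (sigma_gt0 : 0 < sigma).
Implicit Types (n : nat) (p eta : R) (i k : grid d N) (g s : moves d)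
  (f : grid d N -> R).

Local Notation stays g i := (stays K h g i).
Local Notation act g i := (act K h g i).
Local Notation c i g := (rate K h sigma V i g).
Local Notation m i := (mh K h sigma V i).
Local Notation tau := (tau N K h sigma V).
Local Notation pi := (@pi_op R d N K h sigma V).
Local Notation U i := (Vh h V (pt K h i)).
Local Notation kappa := (kappa_phi N K h sigma V).
Local Notation H p f := (entropy K h sigma V (phi (1 + p)) f).
Local Notation edge_kappa :=
  (edge_curv (Defs.act K h) (@opp_move d) (rate K h sigma V)).

Lemma act_neq g i : stays g i -> act g i != i.
Proof.
move=> si; apply/eqP => ai; have := act_coord1 h_gt0 si; rewrite ai.
have := staysE K h_gt0 g i; rewrite si; case: g.2; lia.
Qed.

Lemma rate_nstays i g : ~~ stays g i -> c i g = 0.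
Proof. by rewrite /rate => /negbTE ->. Qed.

Lemma rate_ge0 i g : 0 <= c i g.
Proof.
rewrite /rate; case: ifP => // _.
by rewrite mulr_ge0 ?expR_ge0// divr_ge0 ?sqr_ge0.
Qed.

Lemma rate_gt0 i g : stays g i -> 0 < c i g.
Proof.
by rewrite /rate => ->; rewrite mulr_gt0 ?expR_gt0// divr_gt0// exprn_gt0.
Qed.

Lemma Zpart_gt0 i : 0 < Zpart N K h sigma V.
Proof.
rewrite /Zpart (bigD1 i)//= ltr_pwDl//; first exact: expR_gt0.
by rewrite sumr_ge0// => k _; exact: expR_ge0.
Qed.

Lemma mh_gt0 i : 0 < m i.
Proof. by rewrite /mh mulr_gt0 ?expR_gt0// invr_gt0 (Zpart_gt0 i). Qed.

Lemma sum_mh i : \sum_(k : grid d N) m k = 1.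
Proof. by rewrite /mh -mulr_sumr mulVf// gt_eqF// (Zpart_gt0 i). Qed.

(* In the product m i * c i g the potential appears symmetrically, whence the
   reversibility of the chain. *)
Definition flow i g := m i * c i g.

Lemma flowE i g : stays g i -> flow i g =
  (Zpart N K h sigma V)^-1 * (sigma ^+ 2 / h ^+ 2) *
  expR (- ((U i + U (act g i)) / (2 * sigma ^+ 2))).
Proof.
move=> si; rewrite /flow /mh /rate si -(pt_act si) mulrACA -expRD.
by congr (_ * expR _); field; rewrite !gt_eqF.
Qed.

Lemma flow_ge0 i g : 0 <= flow i g.
Proof. by rewrite mulr_ge0 ?rate_ge0// ltW// mh_gt0. Qed.

Lemma flow_gt0 i g : stays g i -> 0 < flow i g.
Proof. by move=> si; rewrite mulr_gt0 ?rate_gt0// mh_gt0. Qed.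

Lemma flow_nstays i g : ~~ stays g i -> flow i g = 0.
Proof. by move=> si; rewrite /flow rate_nstays// mulr0. Qed.

Lemma flow_opp i g : stays g i -> flow (act g i) (opp_move g) = flow i g.
Proof.
move=> si; rewrite (flowE si) (flowE (stays_opp h_gt0 si)).
by rewrite (actK h_gt0 si) (addrC (U i)).
Qed.

Lemma sum_flow_flip0 (F : grid d N -> moves d -> R) :
  (forall i g, ~~ stays g i -> F i g = 0) ->
  (forall i g, stays g i -> F (act g i) (opp_move g) = - F i g) ->
  \sum_i \sum_g F i g = 0.
Proof.
apply: sum_flip0; first exact: opp_moveK.
  by move=> g i; exact: stays_opp.
by move=> g i; exact: actK.
Qed.

(** * The transition operator and its invariant measure *)

Lemma pi_opE f i : pi f i = f i + tau * \sum_g c i g * (f (act g i) - f i).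
Proof.
rewrite /Defs.pi_op (bigD1 i)//= {1}/trans eqxx.
(* After the exchange of the sums, each move that stays in the grid has a single destination,
   different from [i]. *)
have -> : \sum_(k | k != i) trans K h sigma V i k * f k =
    \sum_g c i g / Tmax N K h sigma V * f (act g i).
  under eq_bigr => k ki do rewrite /trans (negbTE ki) big_mkcond mulr_suml.
  rewrite exchange_big/=; apply: eq_bigr => g _.
  have [si|si] := boolP (stays g i); last first.
    rewrite rate_nstays// !mul0r big1// => k _.
    by case: ifP; rewrite mul0r.
  rewrite (bigD1 (act g i)) ?act_neq//= pt_act// eqxx big1 ?addr0// => k.
  move=> /andP[_]; case: ifP => [/eqP kP|]; last by rewrite mul0r.
  by have [_ ->] := act_eq h_gt0 kP; rewrite eqxx.
rewrite /Defs.tau mulr_sumr mulrBl mul1r -addrA; congr (_ + _).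
rewrite mulr_suml mulr_suml -sumrN -big_split/=; apply: eq_bigr => g _; ring.
Qed.

Lemma tau_ge0 : 0 <= tau.
Proof.
rewrite invr_ge0 mulr_ge0//; elim/big_ind: _ => // [x y x0 y0|i _].
  by rewrite le_max x0.
by rewrite sumr_ge0// => g _; exact: rate_ge0.
Qed.

(** The one half comes from the factor 2 in [Tmax]; it leaves room for the moves of two coupled
    chains in one time step. *)
Lemma tau_rate_le i : tau * \sum_g c i g <= 2^-1.
Proof.
have le_T : 2 * \sum_g c i g <= Tmax N K h sigma V.
  by rewrite ler_pM2l// /Tmax; apply: (le_bigmax _ (fun i => \sum_g c i g)).
have := tau_ge0; rewrite /Defs.tau.
(* If all rates vanish, then [tau] is the inverse of 0, which is 0. *)
have [->|Tn0] := eqVneq (Tmax N K h sigma V) 0.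
  by rewrite invr0 mul0r invr_ge0.
rewrite invr_ge0 le_eqVlt eq_sym (negbTE Tn0)/= => T0.
by rewrite mulrC ler_pdivrMr// ler_pdivlMl.
Qed.

Lemma trans_ge0 i k : 0 <= trans K h sigma V i k.
Proof.
rewrite /trans; case: ifP => _.
  have := tau_rate_le i; rewrite mulrC /Defs.tau; lra.
rewrite sumr_ge0// => g _; rewrite mulr_ge0 ?rate_ge0//; exact: tau_ge0.
Qed.

Lemma pi_op_cst a : pi (fun=> a) = fun=> a.
Proof.
apply/funext => i; rewrite pi_opE big1 ?mulr0 ?addr0// => g _.
by rewrite subrr mulr0.
Qed.

Lemma sum_trans i : \sum_k trans K h sigma V i k = 1.
Proof.
have := congr1 (fun f => f i) (pi_op_cst 1).
rewrite /Defs.pi_op => E; rewrite -[RHS]E.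
by apply: eq_bigr => k _; rewrite mulr1.
Qed.

Lemma pi_op_ge0 f : (forall i, 0 <= f i) -> forall i, 0 <= pi f i.
Proof.
by move=> f0 i; rewrite sumr_ge0// => k _; rewrite mulr_ge0 ?trans_ge0.
Qed.

Lemma pi_op_bounds f a b : (forall i, a <= f i <= b) ->
  forall i, a <= pi f i <= b.
Proof.
move=> fab i; have ea : pi (fun=> a) i = a by rewrite pi_op_cst.
have eb : pi (fun=> b) i = b by rewrite pi_op_cst.
rewrite -{1}ea -{1}eb; apply/andP; split; apply: ler_sum => k _.
  by rewrite ler_wpM2l ?trans_ge0//; case/andP: (fab k).
by rewrite ler_wpM2l ?trans_ge0//; case/andP: (fab k).
Qed.

(** Invariance of [mh]: by detailed balance, the flow times the increment of [f] is antisymmetric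
    under reversal of edges. *)
Lemma sum_pi_op f : \sum_i pi f i * m i = \sum_i f i * m i.
Proof.
under eq_bigr => i _ do rewrite pi_opE mulrDl.
rewrite big_split/= -[RHS]addr0; congr (_ + _).
transitivity (tau * \sum_i \sum_g flow i g * (f (act g i) - f i)).
  rewrite mulr_sumr; apply: eq_bigr => i _; rewrite -mulrA; congr (_ * _).
  by rewrite mulr_suml; apply: eq_bigr => g _; rewrite /flow; ring.
rewrite sum_flow_flip0 ?mulr0// => i g si; first by rewrite flow_nstays// mul0r.
by rewrite flow_opp// actK//; ring.
Qed.

Lemma rateE i g : stays g i ->
  c i g = sigma ^+ 2 / h ^+ 2 *
    expR (- ((U (act g i) - U i) / (2 * sigma ^+ 2))).
Proof. by move=> si; rewrite /rate si (pt_act si). Qed.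

(** Both sides follow a path from [i] to the opposite corner of a square, and along either path the
    exponents add up to the same potential difference. *)
Lemma rate_rate i s g : g.1 != s.1 -> stays s i -> stays g i ->
  c i s * c (act s i) g = c i g * c (act g i) s.
Proof.
move=> gs si gi.
have gsi : stays g (act s i) by rewrite stays_act.
have sgi : stays s (act g i) by rewrite stays_act// eq_sym.
rewrite (rateE si) (rateE gi) (rateE gsi) (rateE sgi) (actC h_gt0 gs si gi).
move: (U (act s i)) (U (act g i)) (U (act s (act g i))) (U i) => us ug usg u.
by rewrite ![_ * expR _ * _]mulrACA -!expRD; congr (_ * expR _); ring.
Qed.

Lemma flow_rate i s g : flow i s * c i g = flow i g * c i s.
Proof. exact: mulrAC. Qed.

Lemma flow_rate_act i s g : g.1 != s.1 -> stays s i -> stays g i ->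
  flow i s * c (act s i) g = flow i g * c (act g i) s.
Proof.
move=> gs si gi; transitivity (m i * (c i s * c (act s i) g)).
  exact/esym/mulrA.
by rewrite (rate_rate gs si gi); exact: mulrA.
Qed.

Lemma mean_cst i a : \sum_(k : grid d N) a * m k = a.
Proof. by rewrite -mulr_sumr sum_mh// mulr1. Qed.

Lemma mean_ge0 f : (forall i, 0 <= f i) -> 0 <= \sum_i f i * m i.
Proof.
by move=> f0; rewrite sumr_ge0// => i _; rewrite mulr_ge0// ltW// mh_gt0.
Qed.

(** * Entropy production and Fisher information *)

Lemma phi_pi_op_le p f i : 0 <= p <= 1 -> (forall i, 0 <= f i) ->
  phi (1 + p) (pi f i) <= pi (fun k => phi (1 + p) (f k)) i.
Proof.
move=> p01 f0; have pif0 : forall k, 0 <= pi f k by exact: pi_op_ge0.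
(* Jensen's inequality through the tangent at the mean. A mean equal to 0 is separated, as there may
   be no tangent at 0; then [f] vanishes at every point reached with positive probability. *)
set q := phi _; have [pi0|pin0] := eqVneq (pi f i) 0.
  have tf k : trans K h sigma V i k = 0 \/ f k = 0.
    have := @psumr_eq0P _ _ predT (fun k => trans K h sigma V i k * f k).
    move=> /(_ (fun k _ => mulr_ge0 (trans_ge0 i k) (f0 k)) pi0 k isT).
    by move=> /eqP; rewrite mulf_eq0 => /orP[] /eqP; [left|right].
  rewrite pi0 -[leLHS](mul1r (q 0)) -(sum_trans i).
  rewrite mulr_suml; apply: ler_sum => k _.
  by case: (tf k) => ->; rewrite ?mul0r.
have x0 : 0 < pi f i by rewrite lt_neqAle eq_sym pin0 pif0.
have -> : q (pi f i) = \sum_k trans K h sigma V i k *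
   (q (pi f i) + (1 + p) * psi p (pi f i) * (f k - pi f i)).
  under [RHS]eq_bigr => k _ do rewrite mulrDr mulrCA mulrBr.
  rewrite big_split/= -mulr_suml sum_trans mul1r -mulr_sumr sumrB.
  by rewrite -mulr_suml sum_trans mul1r -/(pi f i) subrr mulr0 addr0.
apply: ler_sum => k _; rewrite ler_wpM2l ?trans_ge0//.
by rewrite phi_tangent// gt0_psi_dom.
Qed.

Lemma entropy_pi_op_le p f : 0 <= p <= 1 -> (forall i, 0 <= f i) ->
  H p (pi f) <= H p f.
Proof.
move=> p01 f0; rewrite /entropy sum_pi_op// lerD2r.
rewrite -(sum_pi_op (fun i => phi (1 + p) (f i))).
by apply: ler_sum => i _; rewrite ler_wpM2r ?(ltW (mh_gt0 _))// phi_pi_op_le.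
Qed.

(** Real-valued version of [fisher], with which it agrees when all values lie in [psi_dom p]. *)
Definition real_fisher p f := 2^-1 *
  \sum_i \sum_g flow i g * ((1 + p) * theta p (f i) (f (act g i))).

Lemma real_fisher_ge0 p f : 0 <= p <= 1 -> (forall i, psi_dom p (f i)) ->
  0 <= real_fisher p f.
Proof.
move=> p01 fd; rewrite mulr_ge0 ?invr_ge0// sumr_ge0// => i _.
rewrite sumr_ge0// => g _; rewrite mulr_ge0 ?flow_ge0//.
by rewrite mulr_ge0 ?theta_ge0//; case/andP: p01 => ? _; rewrite addr_ge0.
Qed.

Lemma fisherE p f : 0 <= p <= 1 -> (forall i, psi_dom p (f i)) ->
  fisher K h sigma V (1 + p) f = (real_fisher p f)%:E.
Proof.
move=> p01 fd; rewrite /fisher /dirichlet /real_fisher EFinM -sumEFin.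
congr (_ * _)%E; apply: eq_bigr => i _; rewrite -sumEFin.
apply: eq_bigr => g _; rewrite !dphi_psi// -!EFinB -!EFinM; congr EFin.
by rewrite /flow /theta; ring.
Qed.

(** The tangent of [phi] at [f i] bounds the loss of entropy by the mean of [phi' f * (f - pi f)],
    which is [tau] times the Fisher information by summation by parts. *)
Lemma entropy_sub_le p f : 0 <= p <= 1 -> (forall i, psi_dom p (f i)) ->
  H p f - H p (pi f) <= tau * real_fisher p f.
Proof.
move=> p01 fd; have f0 i : 0 <= f i by case/andP: (fd i).
have pif0 : forall k, 0 <= pi f k by exact: pi_op_ge0.
rewrite /entropy sum_pi_op// opprB addrA subrK -sumrB.
have -> : tau * real_fisher p f =
    \sum_i (1 + p) * psi p (f i) * (f i - pi f i) * m i.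
  transitivity (- tau * (1 + p) *
      \sum_i \sum_g flow i g * (psi p (f i) * (f (act g i) - f i))); last first.
    rewrite mulr_sumr; apply: eq_bigr => i _; rewrite pi_opE// opprD addNKr.
    rewrite !mulr_sumr -sumrN mulr_sumr mulr_suml; apply: eq_bigr => g _.
    by rewrite /flow; ring.
  (* Antisymmetric under reversal of edges; this symmetrizes the one-sided sum. *)
  have : \sum_i \sum_g flow i g * ((psi p (f i) + psi p (f (act g i))) *
      (f (act g i) - f i)) = 0.
    apply: sum_flow_flip0 => i g si; first by rewrite flow_nstays// mul0r.
    by rewrite flow_opp// actK//; ring.
  rewrite /real_fisher.
  have -> : \sum_i \sum_g flow i g * ((psi p (f i) + psi p (f (act g i))) *
      (f (act g i) - f i)) =
    2 * \sum_i \sum_g flow i g * (psi p (f i) * (f (act g i) - f i)) +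
    \sum_i \sum_g flow i g * theta p (f i) (f (act g i)).
    rewrite mulr_sumr -big_split/=; apply: eq_bigr => i _.
    rewrite mulr_sumr -big_split/=; apply: eq_bigr => g _.
    by rewrite /theta; ring.
  have -> : \sum_i \sum_g flow i g * ((1 + p) * theta p (f i) (f (act g i))) =
    (1 + p) * \sum_i \sum_g flow i g * theta p (f i) (f (act g i)).
    by rewrite mulr_sumr; apply: eq_bigr => i _; rewrite mulr_sumr;
       apply: eq_bigr => g _; ring.
  move: (\sum_i _) (\sum_i _) => x y xy.
  have -> : tau * (2^-1 * ((1 + p) * x)) = tau * (1 + p) * (2^-1 * x) by ring.
  have -> : 2^-1 * x = - y by lra.
  by ring.
apply: ler_sum => i _; rewrite -mulrBl ler_wpM2r ?(ltW (mh_gt0 _))//.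
have := phi_tangent p01 (fd i) (pif0 i); rewrite -!(opprB (f i)) mulrN => ?.
by lra.
Qed.

(** The chain stays in place with probability at least one half. *)
Lemma pi_op_gt0 f : (forall i, 0 < f i) -> forall i, 0 < pi f i.
Proof.
move=> f0 i; rewrite pi_opE//.
have -> : \sum_g c i g * (f (act g i) - f i) =
    \sum_g c i g * f (act g i) - (\sum_g c i g) * f i.
  by rewrite mulr_suml -sumrB; apply: eq_bigr => g _; rewrite mulrBr.
have : 0 <= tau * \sum_g c i g * f (act g i).
  rewrite mulr_ge0 ?tau_ge0// sumr_ge0// => g _.
  by rewrite mulr_ge0 ?rate_ge0// ltW.
have := ler_wpM2r (ltW (f0 i)) (tau_rate_le i).
by have := f0 i; lra.
Qed.

(** * Positive edge curvature and contraction of the Fisher information *)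

Lemma kappa_plusE i j : kappa_plus K h sigma V i j = edge_kappa i (plus_ j).
Proof. by []. Qed.

Lemma kappa_minusE i j : kappa_minus K h sigma V i j = edge_kappa i (minus_ j).
Proof.
rewrite /kappa_minus /edge_curv; congr (_ - _); apply: eq_bigl => g.
by rewrite /transverse andbC.
Qed.

Hypothesis kappa_plus_gt0 : forall i j, stays (plus_ j) i ->
  0 < kappa_plus K h sigma V i j.
Hypothesis kappa_minus_gt0 : forall i j, stays (minus_ j) i ->
  0 < kappa_minus K h sigma V i j.

Lemma edge_kappa_gt0 i g : stays g i -> 0 < edge_kappa i g.
Proof.
case: g => j [] si; first by rewrite -kappa_plusE kappa_plus_gt0.
by rewrite -kappa_minusE kappa_minus_gt0.
Qed.

(** The infimum runs over edges oriented by plus moves; an edge oriented by a minus move is one of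
    these seen from its other endpoint. *)
Lemma kappa_phi_le i g : stays g i ->
  kappa <= edge_kappa i g + edge_kappa (act g i) (opp_move g).
Proof.
have plus_le i' j : stays (plus_ j) i' ->
    kappa <= edge_kappa i' (plus_ j) + edge_kappa (act (plus_ j) i') (minus_ j).
  move=> si; rewrite -kappa_plusE -kappa_minusE; apply: ge_inf; last first.
    by exists i', j.
  exists 0 => _ [k [l [kl ->]]]; apply: addr_ge0; apply: ltW.
    exact: kappa_plus_gt0.
  by apply: kappa_minus_gt0; exact: (stays_opp h_gt0 kl).
case: g => j [] si; first exact: plus_le.
rewrite addrC -{2}(actK h_gt0 si); apply: plus_le.
exact: (stays_opp h_gt0 si).
Qed.

Lemma real_fisher_contraction p f : 0 <= p <= 1 -> (forall i, 0 < f i) ->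
  real_fisher p (pi f) <= (1 - tau * kappa) * real_fisher p f.
Proof.
move=> p01 f0.
have stepE : chain_step (Defs.act K h) (rate K h sigma V) tau f = pi f.
  by apply/funext => i; rewrite pi_opE.
have fisher_theta u : real_fisher p u = 2^-1 * (1 + p) *
    \sum_i \sum_g flow i g * theta p (u i) (u (act g i)).
  rewrite -mulrA; congr (_ * _); rewrite mulr_sumr; apply: eq_bigr => i _.
  by rewrite mulr_sumr; apply: eq_bigr => g _; rewrite mulrCA.
rewrite !fisher_theta mulrCA ler_wpM2l//.
  by case/andP: p01 => p0 _; rewrite mulr_ge0 ?invr_ge0// addr_ge0.
rewrite -stepE.
apply: (@dirichlet_contraction R _ _
  (Defs.act K h) (Defs.stays K h) (@opp_move d)).
- exact: opp_moveK.
- exact: opp_move_neq.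
- by move=> g i; exact: stays_opp.
- by move=> g i; exact: actK.
- by move=> s g i; rewrite transverse_coord => sg _; exact: stays_act.
- by move=> s g i; rewrite transverse_coord => sg; exact: actC.
- by move=> *; exact: rate_ge0.
- by move=> *; exact: rate_nstays.
- by move=> *; exact: flow_ge0.
- by move=> *; exact: flow_nstays.
- by move=> *; exact: flow_opp.
- exact: flow_rate.
- by move=> i s g; rewrite transverse_coord; exact: flow_rate_act.
- exact: thetaC.
- exact: thetaxx.
- by move=> x y x0 y0; rewrite theta_ge0// gt0_psi_dom.
- move=> a0 b0 a00 b00.
  pose q := psi p a0 - psi p b0.
  (* The partial derivatives of [theta p] at [(a0, b0)], and the constant that makes the affine
     function exact there. *)
  exists (q + (a0 - b0) * a0 `^ (p - 1)), (- q - (a0 - b0) * b0 `^ (p - 1)),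
    ((a0 - b0) * (b0 `^ (p - 1) * b0 - a0 `^ (p - 1) * a0)); split.
    by rewrite /theta -/q; ring.
  move=> a b a_gt0 b_gt0.
  apply: le_trans (theta_subgradient p01 a00 b00 a_gt0 b_gt0).
  by rewrite -/q le_eqVlt; apply/orP; left; apply/eqP; ring.
- exact: tau_ge0.
- by move=> i; exact: tau_rate_le.
- by move=> i s si; rewrite ltW// edge_kappa_gt0.
- exact: f0.
- by move=> i; rewrite stepE; exact: pi_op_gt0.
- by move=> i s; exact: kappa_phi_le.
Qed.

(** * Bounds of the entropy by the oscillation and by the Fisher information *)

Lemma entropy_le_osc (i0 : grid d N) p (b0 b1 : R) : 0 <= p <= 1 -> 0 < b0 ->
  exists2 C, 0 <= C &
  forall f eta, 0 <= eta -> (forall i, b0 <= f i <= b1) ->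
  (forall i g, stays g i -> `|f i - f (act g i)| <= eta) -> H p f <= C * eta.
Proof.
move=> p01 b00; have /andP[p0 p1] := p01.
exists ((1 + p) * (`|psi p b0| + `|psi p b1|) * (d * N)%:R).
  by rewrite !mulr_ge0// addr_ge0.
move=> f eta eta0 fb fe.
have f0 i : 0 < f i by case/andP: (fb i) => /(lt_le_trans b00).
set M := \sum_i f i * m i.
have fM i : `|f i - M| <= (d * N)%:R * eta.
  have -> : f i - M = \sum_k (f i - f k) * m k.
    under [RHS]eq_bigr => k _ do rewrite mulrBl.
    by rewrite sumrB -mulr_sumr (sum_mh i) mulr1.
  apply: (le_trans (ler_norm_sum _ _ _)).
  rewrite -[leRHS](mean_cst i).
  apply: ler_sum => k _; rewrite normrM (gtr0_norm (mh_gt0 _)).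
  apply: ler_wpM2r; first exact/ltW/mh_gt0.
  exact: (edges_connect h_gt0 eta0 fe).
have M0 : 0 <= M by apply: mean_ge0 => i; exact: ltW.
rewrite /entropy -/M.
rewrite -[X in _ - X](mean_cst i0).
rewrite -sumrB -[leRHS](mean_cst i0).
apply: ler_sum => i _; rewrite -mulrBl ler_wpM2r ?(ltW (mh_gt0 _))//.
(* The tangent at [f i], evaluated at the mean, makes the entropy linear in the oscillation; its
   slope is bounded since [psi p] is monotone between [b0] and [b1]. *)
have := phi_tangent p01 (gt0_psi_dom p (f0 i)) M0.
have psi_le : `|psi p (f i)| <= `|psi p b0| + `|psi p b1|.
  have /andP[bf fb1] := fb i.
  have := ler_psi p01 (gt0_psi_dom p b00) bf.
  have := ler_psi p01 (gt0_psi_dom p (f0 i)) fb1.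
  move: (psi p b0) (psi p b1) (psi p (f i)) => x y z zy xz.
  rewrite ler_norml; apply/andP; split.
    by have := ler_norm (- x); rewrite normrN; have := normr_ge0 y; lra.
  by have := ler_norm y; have := normr_ge0 x; lra.
have : (1 + p) * psi p (f i) * (f i - M) <=
    (1 + p) * (`|psi p b0| + `|psi p b1|) * (d * N)%:R * eta.
  rewrite -!mulrA ler_wpM2l ?addr_ge0//.
  by apply: (le_trans (ler_norm _)); rewrite normrM ler_pM.
by move=> *; lra.
Qed.

(** By [theta_ge], each edge term of the Fisher information dominates a squared difference. The
    entropy thus tends to 0 with the Fisher information, uniformly between fixed positive bounds. *)
Lemma entropy_le_fisher (i0 : grid d N) p (b0 b1 : R) : 0 <= p <= 1 -> 0 < b0 ->
  exists C D : R, [/\ 0 <= C, 0 <= D & forall f, (forall i, b0 <= f i <= b1) ->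
    H p f <= C * Num.sqrt (D * real_fisher p f)].
Proof.
move=> p01 b00; have /andP[p0 p1] := p01.
have [C C0 HC] := entropy_le_osc i0 b1 p01 b00.
(* [S] bounds every inverse flow; pairs that are not edges contribute the inverse of 0, which is
   0. *)
pose S := \sum_(i : grid d N) \sum_g (flow i g)^-1.
pose D := 2 * ((1 + p) * b1 `^ (p - 1))^-1 * S.
have p1_gt0 : 0 < 1 + p by rewrite ltr_pwDl.
have S0 : 0 <= S.
  rewrite sumr_ge0// => i _; rewrite sumr_ge0// => g _.
  by rewrite invr_ge0 flow_ge0.
exists C, D; split => //.
  by rewrite mulr_ge0// mulr_ge0// invr_ge0 mulr_ge0 ?powR_ge0// ltW.
move=> f fb; apply: HC => //.
have f0 i : 0 < f i by case/andP: (fb i) => /(lt_le_trans b00).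
have fd i := gt0_psi_dom p (f0 i).
have F0 := real_fisher_ge0 p01 fd.
have b1_gt0 : 0 < b1 by case/andP: (fb i0) => _; exact: lt_le_trans.
move=> i g si; rewrite -sqrtr_sqr ler_wsqrtr//.
have w0 : 0 < flow i g by exact: flow_gt0.
have term_le : flow i g * ((1 + p) * theta p (f i) (f (act g i))) <=
    2 * real_fisher p f.
  rewrite mulVKf//.
  apply: (le_sum_term
    (F := fun i g => flow i g * ((1 + p) * theta p (f i) (f (act g i))))).
  move=> k s; apply: mulr_ge0; first exact: flow_ge0.
  by rewrite mulr_ge0 ?theta_ge0// ltW.
have := theta_ge p01 (_ : 0 < f i <= b1) (_ : 0 < f (act g i) <= b1).
rewrite !f0/=; have /andP[_ ->] := fb i; have /andP[_ ->] := fb (act g i).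
move=> /(_ isT isT) th_ge.
have w_le : (flow i g)^-1 <= S.
  apply: (le_sum_term (F := fun i g => (flow i g)^-1)) => k s.
  by rewrite invr_ge0 flow_ge0.
have e0 : 0 < (1 + p) * b1 `^ (p - 1) by rewrite mulr_gt0// powR_gt0.
have -> : D * real_fisher p f =
    ((1 + p) * b1 `^ (p - 1))^-1 * (S * (2 * real_fisher p f)).
  by rewrite /D; ring.
rewrite ler_pdivlMl//.
apply: (@le_trans _ _ ((flow i g)^-1 * (2 * real_fisher p f))).
  rewrite ler_pdivlMl//; apply: le_trans term_le.
  by rewrite ler_pM2l// -mulrA ler_pM2l.
by rewrite ler_wpM2r// mulr_ge0.
Qed.

(** * Exponential decay for positive functions *)

Lemma iter_pi_op_bounds n f a b : (forall i, a <= f i <= b) ->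
  forall i, a <= iter n pi f i <= b.
Proof. by move=> fab; elim: n => //= n IHn; exact: pi_op_bounds. Qed.

Lemma tau_gt0 i g : stays g i -> 0 < tau.
Proof.
move=> si; rewrite invr_gt0 /Tmax mulr_gt0//.
apply: (@lt_le_trans _ _ (\sum_g c i g)); last first.
  exact: (le_bigmax _ (fun i => \sum_g c i g)).
rewrite (bigD1 g)//= ltr_pwDl ?rate_gt0// sumr_ge0// => s _.
exact: rate_ge0.
Qed.

(** If [kappa] were at most 0, so would be [1 / kappa], whereas [tau] is nonnegative. *)
Lemma kappa_phi_gt0 : tau < 1 / kappa -> 0 < kappa.
Proof. by move=> /(le_lt_trans tau_ge0); rewrite mul1r invr_gt0. Qed.

Lemma kappa_phi_stays : 0 < kappa -> exists i g, stays g i.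
Proof.
rewrite /kappa_phi; set A := [set x | _].
have [->|/set0P[_ [i [j [si _]]]] _] := eqVneq A set0.
  by rewrite inf0 ltxx.
by exists i, (plus_ j).
Qed.

Lemma entropy_decay_gt0 p f n : 0 <= p <= 1 -> (forall i, 0 < f i) ->
  tau < 1 / kappa ->
  H p (iter n pi f) <= real_fisher p f / kappa * (1 - tau * kappa) ^+ n.
Proof.
move=> p01 f0 tau_lt.
have k0 := kappa_phi_gt0 tau_lt.
have [i0 [g0 sg0]] := kappa_phi_stays k0.
have t0 := tau_gt0 sg0.
have tk1 : tau * kappa < 1 by rewrite -ltr_pdivlMr.
have tk0 : 0 < tau * kappa by rewrite mulr_gt0.
set r := 1 - tau * kappa.
have r0 : 0 <= r by rewrite subr_ge0 ltW.
(* These bounds persist under iteration, so one pair of constants from [entropy_le_fisher] serves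
   all times. *)
pose b0 := f [arg min_(i < i0) f i]%O; pose b1 := f [arg max_(i > i0) f i]%O.
have fb i : b0 <= f i <= b1.
  rewrite /b0 /b1; case: Order.TotalTheory.arg_minP => // k _ kmin.
  case: Order.TotalTheory.arg_maxP => // l _ lmax.
  by rewrite kmin//; exact: lmax.
have b00 : 0 < b0 by exact: f0.
have fnb (k : nat) := iter_pi_op_bounds k fb.
have fn0 (k : nat) i : 0 < iter k pi f i.
  by case/andP: (fnb k i) => /(lt_le_trans b00).
have fnd (k : nat) i := gt0_psi_dom p (fn0 k i).
have F0 := real_fisher_ge0 p01 (fnd 0).
have Fn (k : nat) : real_fisher p (iter k pi f) <= r ^+ k * real_fisher p f.
  elim: k => [|k IHk]; first by rewrite mul1r.
  rewrite iterS exprS -mulrA.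
  apply: (le_trans (real_fisher_contraction p01 (fn0 k))).
  by rewrite ler_wpM2l.
(* Partial sums of the geometric series in closed form, using [1 - r = tau * kappa]. *)
have telescope (k : nat) : H p (iter n pi f) <=
    H p (iter (n + k) pi f) + real_fisher p f / kappa * (r ^+ n - r ^+ (n + k)).
  elim: k => [|k IHk]; first by rewrite addn0 subrr mulr0 addr0.
  apply: (le_trans IHk); rewrite addnS iterS.
  have := entropy_sub_le p01 (fnd (n + k)%N).
  have := ler_wpM2l (ltW t0) (Fn (n + k)%N).
  set H0 := H p _; set H1 := H p _ => h1 h2.
  have -> : r ^+ (n + k).+1 = r ^+ (n + k) - tau * kappa * r ^+ (n + k).
    by rewrite exprS /r; ring.
  have -> : real_fisher p f / kappa *
      (r ^+ n - (r ^+ (n + k) - tau * kappa * r ^+ (n + k))) =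
      real_fisher p f / kappa * (r ^+ n - r ^+ (n + k)) +
      tau * (r ^+ (n + k) * real_fisher p f).
    by field; rewrite gt_eqF.
  by lra.
have [C [D [C0 D0 HCD]]] := entropy_le_fisher i0 b1 p01 b00.
rewrite leNgt; apply/negP => lt_H.
(* The limit is taken by contradiction: the square of a positive excess [e] would be bounded by a
   constant times [r ^+ k] for every [k]. *)
pose e := H p (iter n pi f) - real_fisher p f / kappa * r ^+ n.
have e0 : 0 < e by rewrite subr_gt0.
have e_le (k : nat) : e ^+ 2 <= C ^+ 2 * D * real_fisher p f * r ^+ k.
  have rn1 : r ^+ (n + k) <= r ^+ k.
    by rewrite exprD ler_piMl ?exprn_ge0// exprn_ile1// lerBlDr lerDl ltW.
  have eC : e <= C * Num.sqrt (D * real_fisher p (iter (n + k) pi f)).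
    apply: le_trans (HCD _ (fnb (n + k)%N)).
    have := telescope k; rewrite mulrBr /e.
    have : 0 <= real_fisher p f / kappa * r ^+ (n + k).
      by rewrite mulr_ge0 ?exprn_ge0// divr_ge0// ltW.
    by move=> *; lra.
  apply: (@le_trans _ _
    ((C * Num.sqrt (D * real_fisher p (iter (n + k) pi f))) ^+ 2)).
    by rewrite ler_sqr// nnegrE ?(ltW e0)// (le_trans (ltW e0)).
  have F_ge0 : 0 <= real_fisher p (iter (n + k) pi f) by exact: real_fisher_ge0.
  rewrite exprMn (sqr_sqrtr (mulr_ge0 D0 F_ge0)).
  have -> : C ^+ 2 * D * real_fisher p f * r ^+ k =
      C ^+ 2 * (D * (r ^+ k * real_fisher p f)) by ring.
  rewrite ler_wpM2l ?sqr_ge0// ler_wpM2l//.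
  by apply: (le_trans (Fn _)); rewrite ler_wpM2r.
have cv : C ^+ 2 * D * real_fisher p f * r ^+ k @[k --> \oo] --> (0 : R).
  rewrite -[X in _ --> X](mulr0 (C ^+ 2 * D * real_fisher p f)).
  apply: cvgMl_tmp; apply: cvg_expr.
  by rewrite ger0_norm// ltrBlDr ltrDl.
have [l /= lt_e] := filter_ex (cvgr_lt _ cv _ (exprn_gt0 2 e0)).
by have := e_le l; rewrite leNgt lt_e.
Qed.

(** * From positive to nonnegative functions by adding a small constant *)

Lemma pi_opDcst f (e : R) : pi (fun k => f k + e) = fun k => pi f k + e.
Proof.
apply/funext => i; rewrite !pi_opE// addrAC; congr (_ + _ * _ + _).
by apply: eq_bigr => g _; rewrite opprD addrACA subrr addr0.
Qed.

Lemma iter_pi_opDcst n f (e : R) :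
  iter n pi (fun k => f k + e) = fun k => iter n pi f k + e.
Proof. by elim: n => // n IHn; rewrite iterS IHn pi_opDcst. Qed.

Lemma cvg_shift (x : R) : x + e @[e --> 0^'+] --> x.
Proof.
rewrite -[X in _ --> X]addr0; apply: cvgD; first exact: cvg_cst.
exact: cvg_at_right_filter.
Qed.

Lemma cvg_psi_shift p (x : R) : 0 < p -> 0 <= x ->
  psi p (x + e) @[e --> 0^'+] --> psi p x.
Proof.
move=> p0 x0; rewrite /psi gt_eqF//; apply: cvgMr_tmp.
apply: cvgB; last exact: cvg_cst.
have [->|xn0] := eqVneq x 0.
  rewrite powR0 ?gt_eqF//; under eq_fun do rewrite add0r.
  exact: powR_cvg0.
have {x0}xn0 : 0 < x by rewrite lt_neqAle eq_sym xn0.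
have /derivable1_diffP/differentiable_continuous cx :
    derivable (@powR R ^~ p) x 1.
  by apply: derivable_powR; rewrite in_itv/= xn0.
exact: (continuous_cvg (h := @powR R ^~ p) _ cx (@cvg_shift x)).
Qed.

Lemma cvg_phi_shift p (x : R) : 0 < p -> 0 <= x ->
  phi (1 + p) (x + e) @[e --> 0^'+] --> phi (1 + p) x.
Proof.
move=> p0 x0; rewrite phi_psi ?(ltW p0)//.
have phiE : {near 0^'+, (fun e => (x + e) * psi p (x + e) - (x + e) + 1) =1
    (fun e => phi (1 + p) (x + e))}.
  near=> e; rewrite phi_psi ?(ltW p0)// addr_ge0//.
apply: cvg_trans (near_eq_cvg phiE) _.
apply: cvgD; last exact: cvg_cst.
apply: cvgB; last exact: cvg_shift.
by apply: cvgM; [exact: cvg_shift|exact: cvg_psi_shift].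
Unshelve. all: by end_near. Qed.

Lemma cvg_sum_shift (I : finType) (u : I -> R -> R) (l : I -> R) :
  (forall j, u j e @[e --> 0^'+] --> l j) ->
  \sum_j u j e @[e --> 0^'+] --> \sum_j l j.
Proof.
by move=> ul; apply: cvg_big => //; exact: add_continuous.
Qed.

Lemma cvg_entropy_shift (i0 : grid d N) p f : 0 < p -> (forall i, 0 <= f i) ->
  H p (fun i => f i + e) @[e --> 0^'+] --> H p f.
Proof.
move=> p0 f0; rewrite /entropy; apply: cvgB.
  by apply: cvg_sum_shift => i; apply: cvgMr_tmp; exact: cvg_phi_shift.
rewrite (_ : (fun e => _) = fun e => phi (1 + p) (\sum_i f i * m i + e)).
  by apply: cvg_phi_shift => //; exact: mean_ge0.
apply/funext => e; congr (phi _ _).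
rewrite -[e in RHS](mean_cst i0) -big_split/=.
by apply: eq_bigr => i _; rewrite mulrDl.
Qed.

Lemma cvg_fisher_shift p f : 0 < p -> (forall i, 0 <= f i) ->
  real_fisher p (fun i => f i + e) @[e --> 0^'+] --> real_fisher p f.
Proof.
move=> p0 f0; rewrite /real_fisher; apply: cvgMl_tmp.
apply: cvg_sum_shift => i; apply: cvg_sum_shift => g.
apply: cvgMl_tmp; apply: cvgMl_tmp; rewrite /theta.
apply: cvgM; apply: cvgB; try exact: cvg_psi_shift; exact: cvg_shift.
Qed.

Lemma entropy_decay p f n : 0 <= p <= 1 -> (forall i, psi_dom p (f i)) ->
  tau < 1 / kappa ->
  H p (iter n pi f) <= real_fisher p f / kappa * expR (- (kappa * n%:R * tau)).
Proof.
move=> p01 fd tau_lt.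
have f0 i : 0 <= f i by case/andP: (fd i).
have k0 := kappa_phi_gt0 tau_lt.
have [i0 [g0 sg0]] := kappa_phi_stays k0.
have t0 := tau_gt0 sg0.
have tk1 : tau * kappa < 1 by rewrite -ltr_pdivlMr.
apply: (@le_trans _ _ (real_fisher p f / kappa * (1 - tau * kappa) ^+ n));
  last first.
  rewrite ler_wpM2l ?divr_ge0 ?(ltW k0) ?real_fisher_ge0//.
  have -> : - (kappa * n%:R * tau) = (- (tau * kappa)) * n%:R by ring.
  rewrite expRM_natr lerXn2r ?nnegrE ?expR_ge0 ?subr_ge0 ?(ltW tk1)//.
  exact: expR_ge1Dx.
have decay_gt0 := entropy_decay_gt0 n p01.
(* For [p = 0], [psi_dom] already forces positive values; the limit is only needed for [p > 0],
   where everything is continuous at 0. *)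
have [p_gt0|p_le0] := ltP 0 p; last first.
  apply: decay_gt0 => // i.
  by move: (fd i); rewrite /psi_dom (ltNge 0 p) p_le0 orbF => /andP[].
have cF : real_fisher p (fun i => f i + e) / kappa * (1 - tau * kappa) ^+ n
    @[e --> 0^'+] --> real_fisher p f / kappa * (1 - tau * kappa) ^+ n.
  by apply: cvgMr_tmp; apply: cvgMr_tmp; exact: cvg_fisher_shift.
have cH : H p (iter n pi (fun i => f i + e)) @[e --> 0^'+] -->
    H p (iter n pi f).
  under eq_fun do rewrite iter_pi_opDcst.
  apply: cvg_entropy_shift => //; elim: (n) => // n' IHn; exact: pi_op_ge0.
apply: ler_cvg_to cH cF _.
near=> e; apply: decay_gt0 => // i.
by rewrite ltr_wpDl.
Unshelve. all: by end_near. Qed.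

(** * Infinite Fisher information for the logarithmic entropy *)

Lemma dphi1_mul_ge0 (a b : R) : 0 <= a -> 0 <= b ->
  (0 <= (dphi 1 a - dphi 1 b) * (a%:E - b%:E))%E.
Proof.
rewrite (le_eqVlt _ a) (le_eqVlt _ b) => /predU1P[<-|a0] /predU1P[<-|b0].
- by rewrite dphi1_00.
- by rewrite dphi1_0l// leey.
- by rewrite dphi1_0r// leey.
rewrite dphi1_gt0// lee_fin.
have := @theta_ge0 R 0 a b; rewrite lexx ler01 /theta /psi eqxx; apply => //.
  exact: gt0_psi_dom.
exact: gt0_psi_dom.
Qed.

Let fisher1_term f i g : \bar R := ((c i g)%:E *
  ((dphi 1 (f (act g i)) - dphi 1 (f i)) * ((f (act g i))%:E - (f i)%:E)) *
  (m i)%:E)%E.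

Let fisher1_term_ge0 f i g : (forall i, 0 <= f i) ->
  (0 <= fisher1_term f i g)%E.
Proof.
move=> f0; apply: mule_ge0; last by rewrite lee_fin ltW// mh_gt0.
by rewrite mule_ge0 ?lee_fin ?rate_ge0// dphi1_mul_ge0.
Qed.

Lemma fisher1_ge0 f : (forall i, 0 <= f i) -> (0 <= fisher K h sigma V 1 f)%E.
Proof.
move=> f0; apply: mule_ge0; first by rewrite lee_fin invr_ge0.
by apply: sume_ge0 => i _; apply: sume_ge0 => g _; exact: fisher1_term_ge0.
Qed.

Lemma fisher1_pinfty f i g : (forall i, 0 <= f i) -> stays g i ->
  (f i == 0) != (f (act g i) == 0) -> fisher K h sigma V 1 f = +oo%E.
Proof.
move=> f0 si fi; have Fi : fisher1_term f i g = +oo%E.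
  rewrite /fisher1_term.
  have -> : ((dphi 1 (f (act g i)) - dphi 1 (f i)) *
      ((f (act g i))%:E - (f i)%:E) = +oo)%E.
    have [fi0|fi0] := eqVneq (f i) 0; move: fi;
      rewrite ?fi0 ?(negbTE fi0) ?eqxx.
      by move=> fai; rewrite dphi1_0r// lt_neqAle f0 eq_sym andbT.
    rewrite eq_sym eqbF_neg negbK => /eqP ->.
    by rewrite dphi1_0l// lt_neqAle f0 eq_sym fi0.
  by rewrite gt0_muley ?lte_fin ?rate_gt0// gt0_mulye// lte_fin mh_gt0.
have -> : fisher K h sigma V 1 f =
  ((2^-1)%:E * \sum_i \sum_g fisher1_term f i g)%E by [].
rewrite (sum_pinfty _ Fi) ?gt0_muley ?lte_fin// => k s.
exact: fisher1_term_ge0.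
Qed.

(** For [p = 0], if [f] vanishes somewhere but not everywhere, connectedness gives an edge with
    exactly one zero endpoint, where the Fisher information is infinite. *)
Lemma fisher_cases p f : 0 <= p <= 1 -> (forall i, 0 <= f i) ->
  [\/ forall i, psi_dom p (f i), fisher K h sigma V (1 + p) f = +oo%E |
      p = 0 /\ f = fun=> 0].
Proof.
move=> /andP[p0 p1] f0; have [p_gt0|p_le0] := ltP 0 p.
  by constructor 1 => i; rewrite /psi_dom f0 p_gt0 orbT.
have {p0 p_le0}-> : p = 0 by apply/eqP; rewrite eq_le p_le0.
have [/existsP[i /existsP[g /andP[si fi]]]|] :=
  boolP [exists i, exists g, stays g i && ((f i == 0) != (f (act g i) == 0))].
  by constructor 2; rewrite addr0 (fisher1_pinfty f0 si fi).
rewrite negb_exists => /forallP const0.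
have f_eq0 i k : (f i == 0) = (f k == 0).
  (* [edges_connect] with [eta = 0], applied to the indicator function of the zeros of [f]. *)
  have : `|(f i == 0)%:R - (f k == 0)%:R| <= (d * N)%:R * 0 :> R.
    apply: (edges_connect (K := K) h_gt0 (f := fun i => (f i == 0)%:R)) => //.
    move=> j g sj.
    have := const0 j; rewrite negb_exists => /forallP/(_ g).
    by rewrite sj/= negbK => /eqP ->; rewrite subrr normr0.
  rewrite mulr0 normr_le0 subr_eq0 eqr_nat.
  by case: (f i == 0); case: (f k == 0).
have [i /eqP fi0|f_neq0] := pickP (fun i => f i == 0).
  constructor 3; split=> //; apply/funext => k; apply/eqP.
  by rewrite (f_eq0 _ i) fi0.
constructor 1 => i; rewrite gt0_psi_dom// lt_neqAle f0 eq_sym.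
by rewrite f_neq0.
Qed.

End chain.
Theorem theorem12 (R : realType) (d N : nat) (K h sigma : R)
    (V : 'rV[R]_d -> R)
    (d_ge1 : (1 <= d)%N) (K_gt0 : 0 < K) (h_gt0 : 0 < h)
    (hN : 2 * K / h = N%:R) (sigma_gt0 : 0 < sigma) (V_C2 : C2 V)
    (kappa_plus_gt0 : forall (i : grid d N) (j : 'I_d),
       stays K h (plus_ j) i -> 0 < kappa_plus K h sigma V i j)
    (kappa_minus_gt0 : forall (i : grid d N) (j : 'I_d),
       stays K h (minus_ j) i -> 0 < kappa_minus K h sigma V i j)
    (alpha : R) (alpha_ge1 : 1 <= alpha) (alpha_le2 : alpha <= 2) :
  let pi_iter n (f : grid d N -> R) := iter n (pi_op K h sigma V) f in
  let H := @entropy R d N K h sigma V (phi alpha) in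
  let P := @production R d N K h sigma V alpha in
  let F := @fisher R d N K h sigma V alpha in
  let tau := tau N K h sigma V in
  let kappa := kappa_phi N K h sigma V in
  exists C_P : R,
    [/\ 0 < C_P,
        forall (f : grid d N -> R) (n : nat), (forall i, 0 <= f i) ->
          0 <= P (pi_iter n f) /\
          ((P (pi_iter n f))%:E <= C_P%:E * F (pi_iter n f))%E
      & tau < 1 / kappa ->
        forall f : grid d N -> R, (forall i, 0 <= f i) -> 0 < H f ->
        let C_f := (C_P%:E * F f * ((kappa * H f)^-1)%:E)%E in
        forall n : nat,
          ((H (pi_iter n f))%:E
             <= C_f * (expR (- (kappa * n%:R * tau)) * H f)%:E)%E].
Proof.
move=> pi_iter H P F tau kappa.
have [p alphaE] : exists p, alpha = 1 + p by exists (alpha - 1); rewrite subrKC.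
have p01 : 0 <= p <= 1 by apply/andP; split; lra.
have tau0 : 0 <= tau by exact: tau_ge0.
exists 1; split=> // [f n f0|tau_lt f f0 Hf C_f n].
  have g0 : forall i, 0 <= pi_iter n f i.
    by rewrite /pi_iter; elim: n => // n IHn; exact: pi_op_ge0.
  move: (pi_iter n f) g0 => g g0.
  split.
    rewrite /P /production oppr_ge0 mulr_ge0_le0//; first by rewrite invr_ge0.
    by rewrite subr_le0 alphaE; exact: entropy_pi_op_le.
  rewrite mul1e /F /P alphaE.
  have [gd|->|[p0 ->]] := fisher_cases K V h_gt0 sigma_gt0 p01 g0.
  - rewrite fisherE// lee_fin /production -mulrN opprB.
    (* If [tau = 0], the factor [tau^-1] is 0 and so is the production. *)
    rewrite -/tau; have [->|taun0] := eqVneq tau 0.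
      by rewrite invr0 mul0r real_fisher_ge0.
    rewrite ler_pdivrMl ?lt_neqAle 1?eq_sym ?taun0//.
    exact: entropy_sub_le.
  - exact: leey.
  - rewrite /production pi_op_cst// subrr mulr0 oppr0 p0 addr0.
    exact: fisher1_ge0.
have kappa0 : 0 < kappa := kappa_phi_gt0 tau_lt.
have [i0 _] := kappa_phi_stays kappa0.
rewrite /C_f mul1e /F alphaE; move: Hf; rewrite /H alphaE => Hf.
have [fd|->|[p0 fE]] := fisher_cases K V h_gt0 sigma_gt0 p01 f0.
- rewrite fisherE// -!EFinM lee_fin.
  apply: le_trans (entropy_decay h_gt0 sigma_gt0
    kappa_plus_gt0 kappa_minus_gt0 n p01 fd tau_lt) _.
  rewrite le_eqVlt; apply/orP; left; apply/eqP.
  by rewrite -/kappa -/tau; field; rewrite !gt_eqF.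
- rewrite gt0_mulye ?lte_fin ?invr_gt0 ?mulr_gt0//.
  by rewrite gt0_mulye ?leey// lte_fin mulr_gt0// expR_gt0.
(* The zero function has zero entropy, contrary to [Hf]. *)
- move: Hf; rewrite /entropy fE (mean_cst K h sigma V i0).
  by rewrite big1 ?subrr ?ltxx// => i _; rewrite mul0r.
Qed.
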